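(* Let $G$ be a closed graph on $[n]$, labeled so that it is closed with respect to its labeling. Then the regularity of $J_G$ and the regularity of $\operatorname{in}_{\mathrm{lex}}(J_G)$ do not depend on the characteristic of the base field $K$; that is, each of $\operatorname{reg}(J_G)$ and $\operatorname{reg}(\operatorname{in}_{\mathrm{lex}}(J_G))$ takes the same value for every choice of the field $K$.
   Context: Let $K$ be a field and $S=K[x_1,\ldots,x_n,y_1,\ldots,y_n]$ the standard graded polynomial ring in $2n$ variables. Graphs are finite and simple. For a graph $G$ on $[n]=\{1,\ldots,n\}$ with edge set $E(G)$, the binomial edge ideal of $G$ is $J_G=(x_iy_j-x_jy_i : \{i,j\}\in E(G),\ i<j)\subset S$. $\operatorname{in}_{\mathrm{lex}}(J_G)$ denotes the initial ideal of $J_G$ with respect to the lexicographic order induced by $x_1>\cdots>x_n>y_1>\cdots>y_n$, and $\operatorname{reg}$ denotes Castelnuovo--Mumford regularity over $S$. The graph $G$ is closed with respect to its given labeling if for all distinct edges $\{i,j\},\{i,k\}\in E(G)$ such that either $i<j$ and $i<k$, or $i>j$ and $i>k$, one has $\{j,k\}\in E(G)$. $G$ is closed if it is closed with respect to some labeling of its vertices. *)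

(* Defs.v *)
From HB Require Import structures.
From mathcomp Require Import all_boot all_order all_algebra.
From mathcomp Require Import mpoly.

Set Implicit Arguments.
Unset Strict Implicit.
Unset Printing Implicit Defensive.

Import GRing.Theory Num.Theory.
Local Open Scope ring_scope.

(* A simple graph on [n] is a symmetric irreflexive relation on 'I_n, so the
   vertices are 0, ..., n-1 rather than 1, ..., n. *)
Definition simple_graph n (e : rel 'I_n) : Prop :=
  ssrbool.symmetric e /\ irreflexive e.

Definition closed_labeling n (e : rel 'I_n) : Prop :=
  forall i j k : 'I_n, e i j -> e i k -> j != k ->
    ((i < j)%N && (i < k)%N) || ((j < i)%N && (k < i)%N) -> e j k.

Section Ideals.
Variables (K : fieldType) (m : nat).
Implicit Types (f g : {mpoly K[m]}) (I A : {mpoly K[m]} -> Prop).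

Definition ideal_gen A : {mpoly K[m]} -> Prop := fun f =>
  exists2 s : seq ({mpoly K[m]} * {mpoly K[m]}),
    {in s, forall cg, A cg.2} & f = \sum_(cg <- s) cg.1 * cg.2.

(* Pure lexicographic order with 'X_0 > 'X_1 > ...; the order on monomials
   provided by mpoly compares total degrees first. *)
Definition lex_lt (a b : 'X_{1..m}) : bool :=
  [exists i : 'I_m, (a i < b i)%N &&
     [forall j : 'I_m, (j < i)%N ==> (a j == b j)]].

Definition is_lex_lead f (a : 'X_{1..m}) : Prop :=
  a \in msupp f /\ {in msupp f, forall b, b != a -> lex_lt b a}.

Definition in_lex I : {mpoly K[m]} -> Prop :=
  ideal_gen (fun g => exists f a, [/\ I f, is_lex_lead f a & g = 'X_[a]]).

(* Minimal graded free resolution ... -> F_1 -> F_0 -> I -> 0, where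
   F_i = \bigoplus_k S(- mgr_deg i k) with k < mgr_rank i. Elements of F_i are
   row vectors and the maps act by right multiplication: row k of mgr_diff i is
   the image in F_i of the k-th basis element of F_(i+1), and mgr_aug lists the
   images in I of the basis of F_0. Minimality is im (F_(i+1) -> F_i) \subset
   (x_1, ..., x_m) F_i. *)
Record min_graded_res I := MinGradedRes {
  mgr_rank : nat -> nat;
  mgr_deg : forall i, 'I_(mgr_rank i) -> nat;
  mgr_aug : 'cV[{mpoly K[m]}]_(mgr_rank 0);
  mgr_diff : forall i, 'M[{mpoly K[m]}]_(mgr_rank i.+1, mgr_rank i);
  mgr_aug_homog : forall k a,
    a \in msupp (mgr_aug k 0) -> mdeg a = mgr_deg k;
  mgr_diff_homog : forall i k l a,
    a \in msupp (mgr_diff i k l) -> (mdeg a + mgr_deg l)%N = mgr_deg k;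
  mgr_aug_image : forall f,
    I f <-> exists v : 'rV_(mgr_rank 0), f = (v *m mgr_aug) 0 0;
  mgr_exact0 : forall v : 'rV_(mgr_rank 0),
    v *m mgr_aug = 0 <-> exists w : 'rV_(mgr_rank 1), v = w *m mgr_diff 0;
  mgr_exact : forall i (v : 'rV_(mgr_rank i.+1)),
    v *m mgr_diff i = 0 <->
    exists w : 'rV_(mgr_rank i.+2), v = w *m mgr_diff i.+1;
  mgr_minimal : forall i k l, (mgr_diff i k l)@_0%MM = 0
}.

Definition betti I (F : min_graded_res I) (i j : nat) : nat :=
  #|[set k : 'I_(mgr_rank F i) | mgr_deg k == j]|.

(* reg I = max {j - i | beta_(i,j)(I) <> 0}. The value None stands for the
   regularity -oo of the zero ideal, all of whose Betti numbers vanish. The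
   graded Betti numbers do not depend on the minimal resolution. *)
Definition is_reg I (r : option int) : Prop :=
  exists F : min_graded_res I,
    if r is Some d then
      (exists i j, betti F i j != 0%N /\ d = j%:Z - i%:Z) /\
      (forall i j, betti F i j != 0%N -> j%:Z - i%:Z <= d)
    else forall i j, betti F i j = 0%N.

End Ideals.

Section BinomialEdgeIdeal.
Variables (K : fieldType) (n : nat).

(* The variables of S are ordered x_1, ..., x_n, y_1, ..., y_n. *)
Definition xvar (i : 'I_n) : {mpoly K[n + n]} := 'X_(lshift n i).
Definition yvar (i : 'I_n) : {mpoly K[n + n]} := 'X_(rshift n i).

Definition binomial_edge_ideal (e : rel 'I_n) : {mpoly K[n + n]} -> Prop :=
  ideal_gen (fun g => exists i j : 'I_n,
    [/\ (i < j)%N, e i j & g = xvar i * yvar j - xvar j * yvar i]).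

End BinomialEdgeIdeal.

Arguments binomial_edge_ideal K [n] e _.

(* Main.v *)
Require Import Defs.
From HB Require Import structures.
From mathcomp Require Import all_boot all_order all_algebra.
From mathcomp Require Import zify ring.
From mathcomp Require Import mpoly.

Set Implicit Arguments.
Unset Strict Implicit.
Unset Printing Implicit Defensive.

Import Order.TTheory GRing.Theory Num.Theory.
Local Open Scope ring_scope.

(** Let B be the set of pairs i < j with {i,j} an edge. Closedness of the
    labeling says that the upper neighbours of a vertex form a clique, and so
    do its lower neighbours. For theta = 0 or 1 put
    g_ij = x_i y_j - theta x_j y_i, with (i,j) in B. For theta = 1 these
    binomials generate J_G; for theta = 0 they are the monomials x_i y_j, the
    leading monomials of the binomials. Both families are treated at once, and
    over every field the same combinatorial data give a resolution.

    The resolution is found by Schreyer's method: the syzygies of a Groebner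
    basis again form a Groebner basis, whose leading terms are read off from the
    colon ideals (earlier generators : generator). Order the generators by
    decreasing lexicographic order of (i,j). In the colon ideal at x_i y_j, an
    earlier x_i y_k contributes the variable y_k, an earlier x_a y_j contributes
    x_a, and closedness makes any other earlier x_a y_b redundant as soon as
    x_i y_b or x_a y_j is one of the generators. Iterating, a basis element of
    the resolution is a pair (M, U), where M is an induced matching of the
    bipartite graph with edges x_i y_j, and U is a set of variables adjacent to
    M and later than it (symbol_colon). It has homological degree |M| + |U| over
    S/I and degree 2|M| + |U|, so that degree minus homological
    degree is |M|. As the frame needs only the first two maps to start
    (syzygy_row, the S-pairs of the g_ij), this also proves that the g_ij are a
    Groebner basis and hence that the ideal for theta = 0 is the initial ideal
    of the one for theta = 1 (lex_lead_div, in_lexE).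

    Any such finite resolution becomes minimal by cancelling pairs of basis
    elements joined by a unit entry (minimal_complex). Hence
    reg <= max |M| + 1. All maps respect the grading by Z^n in which x_i and
    y_i both have degree e_i, so a cancelled pair has the same multidegree, and
    a basis element that is alone in its multidegree survives. Among the
    induced matchings of maximal size, one that maximizes the sum of the j - i
    has the property that its vertices span no edge of G outside it
    (optimal_pure); then (M, 0) is alone in its multidegree
    (optimal_degree_uniq), and the bound is attained. So both regularities equal
    max |M| + 1 (or are -oo if there is no edge), and K does not occur in this
    number (edge_ideal_reg). *)

(** * Keys of terms *)

Section Key.
Variable m : nat.
Implicit Types (X Y Z : 'X_{1..m}) (r s t : nat).

(** Terms x^a e_t of a free module are compared by the monomial x^a w(t), where
    w(t) is the weight of the basis element e_t, and ties are broken by a rank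
    of t. This is the order induced on syzygies by Schreyer's construction. *)
Definition key_le X r Y s := (X < Y)%O || ((X == Y) && (r <= s)%N).
Definition key_lt X r Y s := (X < Y)%O || ((X == Y) && (r < s)%N).

Lemma key_le_lt_trans Y s X r Z t :
  key_le X r Y s -> key_lt Y s Z t -> key_lt X r Z t.
Proof.
case/orP=> [XY|/andP[/eqP-> rs]]; case/orP=> [YZ|/andP[/eqP<- st]].
- by rewrite /key_lt (lt_trans XY YZ).
- by rewrite /key_lt XY.
- by rewrite /key_lt YZ.
- by rewrite /key_lt eqxx (leq_ltn_trans rs st) orbT.
Qed.

Lemma key_le_add2l b X r Y s :
  key_le (b + X)%MM r (b + Y)%MM s = key_le X r Y s.
Proof. by rewrite /key_le ltmc_add2r eqm_add2l. Qed.

Lemma key_le_monom X r Y s : key_le X r Y s -> (X <= Y)%O.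
Proof. by case/orP=> [/ltW //|/andP[/eqP-> _]]. Qed.

Lemma key_ltW X r Y s : key_lt X r Y s -> key_le X r Y s.
Proof. by case/orP=> [XY|/andP[/eqP-> rs]];
  rewrite /key_le ?XY // eqxx ltnW ?orbT. Qed.

End Key.

(** * Coefficients of products *)

Section MonomialProducts.
Variables (R : idomainType) (m : nat).
Implicit Types p q : {mpoly R[m]}.

Lemma mcoeffM_neq0 p q X : (p * q)@_X != 0 ->
  exists a b, [/\ p@_a != 0, q@_b != 0 & X = (a + b)%MM].
Proof.
rewrite -mcoeff_msupp => /msuppM_le /allpairsP [[a b] /= [ha hb ->]].
by exists a, b; rewrite -!mcoeff_msupp.
Qed.

Lemma mcoeffMX_neq0 p b X : (p * 'X_[b])@_X != 0 ->
  (b <= X)%MM /\ p@_(X - b) = (p * 'X_[b])@_X.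
Proof.
move=> h; have [a [c [ha hc ->]]] := mcoeffM_neq0 h.
move: hc; rewrite mcoeffX; case: (b =P c) => [<- _|_]; last by rewrite eqxx.
by rewrite lem_addl addmK [(a + b)%MM]addmC mcoeffMX.
Qed.

Lemma mlead_le p X : (forall a, p@_a != 0 -> (a <= X)%O) -> (mlead p <= X)%O.
Proof.
move=> h; have [->|nz] := eqVneq p 0; first by rewrite mlead0 le0m.
by apply: h; rewrite mleadc_eq0.
Qed.

End MonomialProducts.

(** * Resolutions by Schreyer's method *)

(** The basis elements of all free modules of the complex are collected in one
    set [A], with homological degree [lv] and weight [w]. The differential is a
    single square matrix D whose row c is to have leading term
    x^(w c - w (par c)) e_(par c). The monomials w s, for s an earlier sibling
    of t, generate an ideal whose colon by w t is to be generated by the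
    quotients w c / w t, for c a child of t; [colonP] says so by testing
    divisibility of the monomials X. The map [cd] is the multigrading to be
    respected. *)
Section Schreyer.
Variables (K : fieldType) (m n N : nat).
Notation S := {mpoly K[m]}.
Implicit Types (X Y Z : 'X_{1..m}) (v u : 'rV[S]_N) (D : 'M[S]_N).
Variables (A : {set 'I_N}) (lv : 'I_N -> nat) (par : 'I_N -> 'I_N)
  (w : 'I_N -> 'X_{1..m}) (rk : 'I_N -> nat) (cd : 'X_{1..m} -> 'X_{1..n}).

Definition child c t := [&& c \in A, (0 < lv c)%N & par c == t].

Hypothesis cdD : {morph cd : X Y / (X + Y)%MM >-> (X + Y)%MM}.
Hypothesis parP : forall t, t \in A -> (0 < lv t)%N ->
  [/\ par t \in A, lv t = (lv (par t)).+1 & (w (par t) <= w t)%MM].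
Hypothesis rk_inj : {in A &, injective rk}.
Hypothesis rk_par : forall s t, s \in A -> t \in A -> (0 < lv s)%N ->
  (0 < lv t)%N -> (rk (par s) < rk (par t))%N -> (rk s < rk t)%N.
Hypothesis colonP : forall t X, t \in A -> (0 < lv t)%N -> (w t <= X)%MM ->
  (exists c, child c t && (w c <= X)%MM) <->
  (exists s, [&& child s (par t), (rk s < rk t)%N & (w s <= X)%MM]).

(** The coefficient of e_t in v at the monomial x^X / x^(w t), that is, the
    coefficient of the term with key (X, t). Indexing by X makes multiplication
    by a monomial a shift of X. *)
Definition tcoef v X t : K := (v 0 t * 'X_[w t])@_X.

Lemma tcoefD v u X t : tcoef (v + u) X t = tcoef v X t + tcoef u X t.
Proof. by rewrite /tcoef mxE mulrDl mcoeffD. Qed.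
Lemma tcoefN v X t : tcoef (- v) X t = - tcoef v X t.
Proof. by rewrite /tcoef mxE mulNr mcoeffN. Qed.
Lemma tcoefB v u X t : tcoef (v - u) X t = tcoef v X t - tcoef u X t.
Proof. by rewrite tcoefD tcoefN. Qed.
Lemma tcoef0 X t : tcoef 0 X t = 0.
Proof. by rewrite /tcoef mxE mul0r mcoeff0. Qed.

Lemma tcoefZX (a : K) b v X t :
  tcoef ((a *: 'X_[b]) *: v) (b + X)%MM t = a * tcoef v X t.
Proof.
by rewrite /tcoef mxE -mulrA -!scalerAl mcoeffZ ['X_[b] * _]mulrC mcoeffMX.
Qed.

Lemma tcoefZX_neq0 (a : K) b v X t : tcoef ((a *: 'X_[b]) *: v) X t != 0 ->
  exists2 Y, X = (b + Y)%MM & tcoef v Y t != 0.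
Proof.
move=> h; have : ('X_[b] * (v 0 t * 'X_[w t]))@_X != 0.
  move: h; rewrite /tcoef mxE -mulrA -scalerAl mcoeffZ.
  by rewrite mulf_eq0 negb_or => /andP[].
case/mcoeffM_neq0 => b' [Y [hb hY ->]].
move: hb; rewrite mcoeffX; case: (b =P b') => [<- _|_]; last by rewrite eqxx.
by exists Y.
Qed.

Lemma tcoef_delta t X s :
  tcoef (delta_mx 0 t) X s = ((s == t) && (X == w s))%:R.
Proof.
rewrite /tcoef !mxE eqxx /=; case: eqP => _ /=; last by rewrite mul0r mcoeff0.
by rewrite mul1r mcoeffX eq_sym.
Qed.

Lemma tcoef_neq0 v X t :
  tcoef v X t != 0 -> (w t <= X)%MM /\ (v 0 t)@_(X - w t) != 0.
Proof. by rewrite /tcoef => h; have [h1 ->] := mcoeffMX_neq0 h. Qed.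

Lemma tcoef_ex v t : v 0 t != 0 -> exists X, tcoef v X t != 0.
Proof.
move=> h; exists (mlead (v 0%R t) + w t)%MM.
by rewrite /tcoef addmC mcoeffMX mleadc_eq0.
Qed.

Lemma mcoeff_tcoef v t a : (v 0 t)@_a = tcoef v (a + w t)%MM t.
Proof. by rewrite /tcoef addmC mcoeffMX. Qed.

Definition leading_row c v :=
  tcoef v (w c) (par c) = 1 /\
  (forall X s, tcoef v X s != 0 ->
     [/\ s \in A, lv c = (lv s).+1, cd X = cd (w c)
       & key_le X (rk s) (w c) (rk (par c))]).

(** What may be added to the leading term of row c. *)
Definition below_lead c v := forall X s, tcoef v X s != 0 ->
  [/\ s \in A, lv c = (lv s).+1, cd X = cd (w c) &
    key_lt X (rk s) (w c) (rk (par c))].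

Lemma below_leadD c u v :
  below_lead c u -> below_lead c v -> below_lead c (u + v).
Proof.
move=> hu hv X s; have [h|/hu//] := eqVneq (tcoef u X s) 0.
by rewrite tcoefD h add0r => /hv.
Qed.

Lemma below_lead_term c s (a : K) b : s \in A -> lv c = (lv s).+1 ->
  cd (b + w s)%MM = cd (w c) -> key_lt (b + w s)%MM (rk s) (w c) (rk (par c)) ->
  below_lead c ((a *: 'X_[b]) *: delta_mx 0 s).
Proof.
move=> sA ls hcd hk X t /tcoefZX_neq0[Y ->]; rewrite tcoef_delta.
case: (t =P s) => [->|_]; last by rewrite eqxx.
by case: (Y =P w s) => [->|_] //; rewrite eqxx.
Qed.

Lemma leading_rowI c b v : par c \in A -> lv c = (lv (par c)).+1 ->
  w c = (b + w (par c))%MM -> below_lead c v ->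
  leading_row c ((1 *: 'X_[b]) *: delta_mx 0 (par c) + v).
Proof.
move=> pA pl wE hv; split.
  rewrite tcoefD wE tcoefZX tcoef_delta !eqxx mulr1 -wE.
  have [->|/hv[_ _ _]] := eqVneq (tcoef v (w c) (par c)) 0;
    first by rewrite addr0.
  by rewrite /key_lt ltxx eqxx ltnn.
move=> X s; have [h|/hv[sA ls hcd hk] _] := eqVneq (tcoef v X s) 0; last first.
  by split=> //; apply: key_ltW.
rewrite tcoefD h addr0 => /tcoefZX_neq0[Y ->]; rewrite tcoef_delta.
case: (s =P par c) => [->|_]; last by rewrite eqxx.
case: (Y =P w (par c)) => [->|_] => [_|]; last by rewrite eqxx.
by rewrite -wE; split=> //; rewrite /key_le eqxx leqnn orbT.
Qed.

Definition reduced v := forall X t, tcoef v X t != 0 ->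
  forall c, child c t -> ~~ (w c <= X)%MM.

(** Division by the rows of D. The relation [R] on keys is any property that
    the reduction steps preserve; it serves to bound keys, levels and
    multidegrees of the quotient and of the remainder. *)
Section NormalForm.
Variables (D : 'M[S]_N) (p : nat) (R : 'X_{1..m} -> 'I_N -> Prop).
Hypothesis Drow :
  forall c, c \in A -> (2 <= lv c <= p)%N -> leading_row c (row c D).
Hypothesis RA : forall X t, R X t -> t \in A /\ (0 < lv t < p)%N.
Hypothesis Rcl : forall X t c, R X t -> child c t -> (w c <= X)%MM ->
  forall Y s, tcoef (row c D) Y s != 0 -> R (X - w c + Y)%MM s.

Definition has_normal_form u := exists u' v,
  [/\ u = u' + v *m D, forall X t, tcoef u' X t != 0 -> R X t, reduced u'
    & forall X c, tcoef v X c != 0 -> child c (par c) /\ R X (par c) ].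

(** The keys are well-founded for the lexicographic combination of the
    monomial order and the order of ranks, so the leading term of u can be
    removed, either by subtracting a multiple of a row or by moving it to the
    remainder. *)
Lemma normal_form_lt X r u :
  (forall Y t, tcoef u Y t != 0 -> R Y t /\ key_lt Y (rk t) X r) ->
    has_normal_form u.
Proof.
elim/(well_founded_ind (@ltom_wf m)): X r u => X IHX r.
elim: r => [|r IHr] u hu.
  have [->|/rV0Pn[t0 ht0]] := eqVneq u 0.
    exists 0, 0; rewrite mul0mx addr0; split=> //.
    - by move=> Y t; rewrite tcoef0 eqxx.
    - by move=> Y t; rewrite tcoef0 eqxx.
    - by move=> Y t; rewrite tcoef0 eqxx.
  have ltX Y t : tcoef u Y t != 0 -> (Y < X)%O.
    by case/hu=> _; rewrite /key_lt ltn0 andbF orbF.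
  pose F t := mlead (u 0 t * 'X_[w t]).
  have X0 : (0%MM < X)%O.
    by have [Y hY] := tcoef_ex ht0; apply: le_lt_trans (le0m _) (ltX _ _ hY).
  have lFX t : (F t < X)%O.
    rewrite /F; have [->|nz] := eqVneq (u 0 t * 'X_[w t]) 0.
      by rewrite mlead0.
    by apply: (ltX _ t); rewrite /tcoef mleadc_eq0.
  (* below (X, 0) there is no largest key; descend to the largest monomial *)
  pose Z := (\join_t F t)%O.
  have ZX : (Z < X)%O.
    apply: (big_ind (fun Y => (Y < X)%O)) => // Y Y'.
    by rewrite ltUx => -> ->.
  apply: (IHX Z ZX (\max_t rk t).+1) => Y t hY; have [hR _] := hu _ _ hY.
  split=> //; have YZ : (Y <= Z)%O.
    apply: le_trans (@joins_sup _ _ _ t predT F isT).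
    by apply: msupp_le_mlead; rewrite mcoeff_msupp.
  rewrite /key_lt; move: YZ; rewrite le_eqVlt => /orP[/eqP->|->//].
  by rewrite eqxx ltnS leq_bigmax orbT.
have [/existsP[t /andP[/eqP rt ht]]|/existsPn hno] :=
  boolP [exists t, (rk t == r) && (tcoef u X t != 0)]; last first.
  apply: IHr => Y t hY; have [hR hlt] := hu _ _ hY; split=> //.
  move: hlt; rewrite /key_lt => /orP[->//|/andP[/eqP eX]].
  rewrite ltnS leq_eqVlt => /orP[/eqP er|->]; last by rewrite eX eqxx orbT.
  by have := hno t; rewrite er eqxx -eX hY.
have [Rt _] := hu _ _ ht; have [tA lt] := RA Rt.
have [wtX _] := tcoef_neq0 ht.
have only Y s : R Y s -> key_lt Y (rk s) X r.+1 -> ~~ key_lt Y (rk s) X r ->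
  Y = X /\ s = t.
  move=> /RA [sA _]; rewrite /key_lt => /orP[->//|/andP[/eqP-> ]].
  rewrite eqxx ltnS leq_eqVlt => /orP[/eqP er|->]; last by rewrite orbT.
  by move=> _; split=> //; apply: rk_inj => //; rewrite er rt.
have [/existsP[c /andP[ct wc]]|/existsPn hno] :=
  boolP [exists c, child c t && (w c <= X)%MM].
  have /and3P[cA lc /eqP pc] := ct.
  have [_ lcE _] := parP cA lc.
  have lc2 : (2 <= lv c <= p)%N by move: lt; rewrite lcE pc; lia.
  have [c1 cle] := Drow cA lc2; rewrite pc in c1 cle.
  pose q : S := tcoef u X t *: 'X_[X - w c].
  have qE Y s : tcoef (q *: row c D) Y s != 0 ->
      R Y s /\ key_le Y (rk s) X (rk t).
    case/tcoefZX_neq0 => Z -> hZ; split; first exact: Rcl Rt ct wc _ _ hZ.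
    have [_ _ _] := cle _ _ hZ.
    by rewrite -(key_le_add2l (X - w c)%MM) [(X - w c + w c)%MM]submK.
  have qX : tcoef (q *: row c D) X t = tcoef u X t.
    by rewrite -{1}(submK wc) tcoefZX c1 mulr1.
  case: (IHr (u - q *: row c D)) => [Y s hY|u' [v [uE hu' hred hv]]].
    have hR : R Y s /\ key_lt Y (rk s) X r.+1.
      have [h1|h1] := boolP (tcoef u Y s == 0).
        have : tcoef (q *: row c D) Y s != 0.
          by move: hY; rewrite tcoefB (eqP h1) sub0r oppr_eq0.
        move=> /qE[hR hl]; split=> //; apply: key_le_lt_trans hl _.
        by rewrite /key_lt eqxx rt ltnSn orbT.
      exact: hu.
    case: hR => hR hlt; split=> //; apply/negPn/negP => hn.
    have [eY es] := only _ _ hR hlt hn.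
    by move: hY; rewrite eY es tcoefB qX subrr eqxx.
  exists u', (v + q *: delta_mx 0 c); split=> //.
    by rewrite mulmxDl -scalemxAl -rowE addrA -uE subrK.
  move=> Y s; have [hv0|/hv//] := eqVneq (tcoef v Y s) 0.
  rewrite tcoefD hv0 add0r => /tcoefZX_neq0 [Z -> ].
  rewrite tcoef_delta; case: (s =P c) => [-> /=|_]; last by rewrite eqxx.
  case: (Z =P w c) => [->|_]; last by rewrite eqxx.
  by rewrite submK // pc.
pose q : S := tcoef u X t *: 'X_[X - w t].
have qX : tcoef (q *: delta_mx 0 t) X t = tcoef u X t.
  by rewrite -{1}(submK wtX) tcoefZX tcoef_delta !eqxx mulr1.
have q0 Y s : tcoef (q *: delta_mx 0 t) Y s != 0 -> Y = X /\ s = t.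
  case/tcoefZX_neq0 => Z ->.
  rewrite tcoef_delta; case: (s =P t) => [-> /=|_]; last by rewrite eqxx.
  by case: (Z =P w t) => [->|_]; rewrite ?eqxx // submK.
case: (IHr (u - q *: delta_mx 0 t)) => [Y s hY|u' [v [uE hu' hred hv]]].
  have hne : ~ (Y = X /\ s = t).
    by case=> eY es; move: hY; rewrite eY es tcoefB qX subrr eqxx.
  have h0 : tcoef (q *: delta_mx 0 t) Y s = 0.
    by apply/eqP/negPn/negP => /q0.
  move: hY; rewrite tcoefB h0 subr0 => /hu[hR hlt]; split=> //.
  by apply/negPn/negP => hn; apply: hne; apply: only.
exists (u' + q *: delta_mx 0 t), v; split=> //.
- by rewrite addrAC -uE subrK.
- move=> Y s; have [h0|/hu'//] := eqVneq (tcoef u' Y s) 0.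
  by rewrite tcoefD h0 add0r => /q0[-> ->].
- move=> Y s; have [h0|/hred//] := eqVneq (tcoef u' Y s) 0.
  rewrite tcoefD h0 add0r => /q0[-> ->] c hc.
  by have := hno c; rewrite hc.
Qed.

Lemma normal_form u :
  (forall X t, tcoef u X t != 0 -> R X t) -> has_normal_form u.
Proof.
move=> hu; pose F t := mlead (u 0 t * 'X_[w t]).
apply: (@normal_form_lt (\join_t F t)%O (\max_t rk t).+1) => Y t hY.
split; first exact: hu.
have YZ : (Y <= \join_t F t)%O.
  apply: le_trans (@joins_sup _ _ _ t predT F isT).
  by apply: msupp_le_mlead; rewrite mcoeff_msupp.
rewrite /key_lt; move: YZ; rewrite le_eqVlt => /orP[/eqP->|->//].
by rewrite eqxx ltnS leq_bigmax orbT.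
Qed.

End NormalForm.

(** The terms of a reduced vector have distinct leading terms under D: of two
    siblings with the same total monomial, the later one has a child dividing
    it. *)
Lemma reduced_uniq v X s t : reduced v ->
  s \in A -> t \in A -> (0 < lv s)%N -> (0 < lv t)%N -> par s = par t ->
  tcoef v X s != 0 -> tcoef v X t != 0 -> s = t.
Proof.
move=> hr; wlog lst : s t / (rk s <= rk t)%N => [H|] sA tA ls lt ep hs ht.
  have [h|h] := leqP (rk s) (rk t); first exact: H.
  by apply/esym/H => //; apply: ltnW.
move: lst; rewrite leq_eqVlt => /orP[/eqP/rk_inj->//|lst].
have [ws _] := tcoef_neq0 hs; have [wt _] := tcoef_neq0 ht.
have [_ [|c /andP[hc wc]]] := colonP tA lt wt.
  by exists s; rewrite lst ws /child sA ls ep eqxx.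
by have := hr _ _ ht _ hc; rewrite wc.
Qed.

(** No cancellation can occur at the top: the image under D of the largest
    term of v has the largest leading term, and by [reduced_uniq] no other term
    of v has an image with that leading term. *)
Lemma reduced_ker D p v :
  (forall c, c \in A -> (0 < lv c <= p)%N -> leading_row c (row c D)) ->
  (forall X t, tcoef v X t != 0 -> t \in A /\ (0 < lv t <= p)%N) ->
  reduced v -> v *m D = 0 -> v = 0.
Proof.
move=> Drow vA hr vD; apply/eqP/negPn/negP => /rV0Pn[t0 ht0].
pose F t := mlead (v 0 t * 'X_[w t]).
case: (@Order.TotalTheory.arg_maxP _ _ _ t0 (fun t => v 0 t != 0) F ht0).
move=> t1 ht1 hmax; pose X := F t1.
have hX : tcoef v X t1 != 0.
  rewrite /tcoef mleadc_eq0; apply/negP => /eqP h0.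
  case: (tcoef_ex ht1) => Y; rewrite /tcoef h0 mcoeff0 eqxx //.
have leX Y t : tcoef v Y t != 0 -> (Y <= X)%O.
  move=> hY; apply: le_trans (hmax t _).
    by apply: msupp_le_mlead; rewrite mcoeff_msupp.
  by apply/negP => /eqP h; move: hY; rewrite /tcoef h mul0r mcoeff0 eqxx.
case: (@arg_maxnP _ t1 (fun t => tcoef v X t != 0) rk hX) => t ht rmax.
have [tA lt] := vA _ _ ht; have /andP[lt0 ltp] := lt.
have [t1c tle] := Drow _ tA lt.
have : (v *m D) 0 (par t) * 'X_[w (par t)] = 0 by rewrite vD mxE mul0r.
move/(congr1 (mcoeff X)); rewrite mcoeff0 mxE mulr_suml raddf_sum /=.
rewrite (bigD1 t) //= big1 ?addr0; last first.
  move=> s nst; apply/eqP/negPn/negP; rewrite -mulrA => /mcoeffM_neq0.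
  case=> a [b [ha hb eX]].
  rewrite mcoeff_tcoef in ha.
  have [sA ls] := vA _ _ ha; have /andP[ls0 _] := ls.
  have [_ sle] := Drow _ sA ls.
  have hb' : tcoef (row s D) b (par t) != 0 by rewrite /tcoef mxE.
  have [_ _ _ hlek] := sle _ _ hb'.
  have bw : (b <= w s)%O := key_le_monom hlek.
  have aw := leX _ _ ha.
  have ebw : b = w s.
    apply/eqP; rewrite eq_le bw /=.
    by rewrite -(lemc_add2r a) -eX.
  have sX : tcoef v X s != 0 by rewrite eX ebw.
  have rst : (rk s <= rk t)%N := rmax _ sX.
  have rst' : (rk (par s) <= rk (par t))%N.
    rewrite leqNgt; apply/negP => /(rk_par tA sA lt0 ls0).
    by rewrite ltnNge rst.
  move: hlek; rewrite ebw /key_le ltxx eqxx /= => hle.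
  have [psA _ _] := parP sA ls0; have [ptA _ _] := parP tA lt0.
  have ep : par s = par t.
    by apply: rk_inj => //; apply/eqP; rewrite eqn_leq rst' hle.
  by move/eqP: nst; apply; apply: (reduced_uniq hr sA tA _ _ ep sX ht).
have [wtX _] := tcoef_neq0 ht.
rewrite -mulrA -{1}(submK wtX) mleadcMW; last 2 first.
- apply: mlead_le => a; rewrite mcoeff_tcoef => /leX h.
  by rewrite -(lemc_add2l _ _ (w t)) submK.
- apply: mlead_le => b hb.
  have hb' : tcoef (row t D) b (par t) != 0 by rewrite /tcoef mxE.
  by have [_ _ _ /key_le_monom] := tle _ _ hb'.
have -> : (D t (par t) * 'X_[w (par t)])@_(w t) = 1.
  by move: t1c; rewrite /tcoef mxE.
have [_] := tcoef_neq0 ht; rewrite mulr1 => /negbTE h /eqP; by rewrite h.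
Qed.

(** The complex constructed up to homological degree p. *)
Definition truncated p D :=
  [/\ forall c, c \in A -> (0 < lv c <= p)%N -> leading_row c (row c D),
      forall c, ~~ ((c \in A) && (0 < lv c <= p)%N) -> row c D = 0
    & D *m D = 0].

Lemma mulmx_eq_rows D D' v :
  (forall t, v 0 t != 0 -> row t D = row t D') -> v *m D = v *m D'.
Proof.
move=> h; rewrite !mulmx_sum_row; apply: eq_bigr => t _.
by have [->|/h->//] := eqVneq (v 0 t) 0; rewrite !scale0r.
Qed.

Lemma truncated_ext p D :
  truncated p D ->
  (forall c, c \in A -> lv c = p.+1 -> exists v, leading_row c v /\ v *m D = 0)
    ->
  exists2 D', truncated p.+1 D' & forall c, (lv c <= p)%N -> row c D' = row c D.
Proof.
case=> Drow D0 DD hex.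
have hex' (c : 'I_N) : exists v : 'rV[S]_N,
    (c \in A) && (lv c == p.+1) -> leading_row c v /\ v *m D = 0.
  case: (boolP ((c \in A) && (lv c == p.+1))) => [/andP[cA /eqP lc]|_].
    by have [v hv] := hex c cA lc; exists v.
  by exists 0.
have [f hf] := fin_all_exists hex'.
pose D' := \matrix_(i, j)
  (if (i \in A) && (lv i == p.+1) then f i 0 j else D i j).
have rowD' c : row c D' = if (c \in A) && (lv c == p.+1) then f c else row c D.
  by apply/rowP => j; rewrite !mxE; case: ifP => _; rewrite ?mxE.
have low c : (lv c <= p)%N -> row c D' = row c D.
  by move=> lc; rewrite rowD' (ltn_eqF (leq_ltn_trans lc (ltnSn p))) andbF.
have ok c : c \in A -> (0 < lv c <= p.+1)%N -> leading_row c (row c D').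
  move=> cA lc; rewrite rowD'; case: ifP => [/hf[]//|].
  by rewrite cA /= => /negbT nl; apply: Drow => //; move: lc nl; lia.
exists D' => //; split=> //.
  move=> c hc; rewrite rowD'; case: ifP hc => [/andP[-> /eqP->]|h hc].
    by rewrite /= leqnn.
  by apply: D0; apply: contra hc => /andP[-> lc] /=; move: lc; lia.
apply/row_matrixP => c; rewrite row_mul row0.
have [hc|hc] := boolP ((c \in A) && (0 < lv c <= p.+1)%N); last first.
  rewrite rowD' ifF; last first.
    by apply: contraNF hc => /andP[-> /eqP->] /=; rewrite leqnn.
  rewrite D0 ?mul0mx //; apply: contra hc => /andP[-> lc] /=; move: lc; lia.
have /andP[cA lc] := hc; have [_ cle] := ok _ cA lc.
rewrite (@mulmx_eq_rows _ D); last first.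
  move=> t /tcoef_ex[X /cle[_ el _ _]]; apply: low.
  by move: lc; rewrite el; lia.
rewrite rowD'; case: ifP => [/hf[]//|_].
by rewrite -row_mul DD row0.
Qed.

(** The row of c is the S-pair of t = par c and of an earlier sibling s whose
    weight divides w c, minus a standard expression for its image. The image
    lies in the kernel of the previous map, so its remainder is reduced and in
    the kernel, hence zero; all keys used lie below (w c, rk t). *)
Lemma truncated_step p D : (2 <= p)%N -> truncated p D ->
  exists2 D', truncated p.+1 D' & forall c, (lv c <= p)%N -> row c D' = row c D.
Proof.
move=> p2 hD; have [Drow D0 DD] := hD; apply: truncated_ext => // c cA lc.
have lc0 : (0 < lv c)%N by rewrite lc.
have [tA ltE wtc] := parP cA lc0; set t := par c in tA ltE wtc *.
have lt : lv t = p by move: ltE; rewrite lc => -[].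
have lt0 : (0 < lv t)%N by rewrite lt; lia.
have [toS _] := colonP tA lt0 wtc.
have [|s /and3P[/and3P[sA ls0 /eqP ps] rst ws]] := toS.
  by exists c; rewrite /child cA lc0 eqxx lepm_refl.
have [ptA ltp _] := parP tA lt0; have [_ lsE _] := parP sA ls0.
have ls : lv s = p by rewrite lsE ps -ltp.
have [t1 tle] : leading_row t (row t D) by apply: Drow => //; rewrite lt; lia.
have [s1 sle] : leading_row s (row s D) by apply: Drow => //; rewrite ls; lia.
pose ut : 'rV[S]_N := (1 *: 'X_[w c - w t]) *: delta_mx 0 t.
pose us : 'rV[S]_N := (1 *: 'X_[w c - w s]) *: delta_mx 0 s.
(* the leading terms of the images of ut and us agree, so they cancel in u0 *)
pose u0 := ut - us.
have u0D : u0 *m D =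
    (1 *: 'X_[w c - w t]) *: row t D - (1 *: 'X_[w c - w s]) *: row s D.
  by rewrite mulmxBl -!scalemxAl -!rowE.
pose R X (a : 'I_N) := [/\ a \in A, lv a = p.-1, cd X = cd (w c)
  & key_lt X (rk a) (w c) (rk (par t))].
have RA X a : R X a -> a \in A /\ (0 < lv a < p)%N.
  by case=> aA -> _ _; split=> //; lia.
have Rcl X a b : R X a -> child b a -> (w b <= X)%MM ->
    forall Y d, tcoef (row b D) Y d != 0 -> R (X - w b + Y)%MM d.
  move=> [aA la Xc hk] /and3P[bA lb /eqP pb] wb Y d hY.
  have [_ lbE _] := parP bA lb; rewrite pb la (ltn_predK p2) in lbE.
  have [_ ble] : leading_row b (row b D) by apply: Drow => //;
    rewrite lbE leqnn ltnW.
  have [dA ld Yc hle] := ble _ _ hY; split=> //.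
  - by rewrite -lbE ld.
  - by rewrite -Xc -{2}(submK wb) !cdD Yc.
  - apply: key_le_lt_trans hk; rewrite pb in hle.
    by rewrite -{2}(submK wb) key_le_add2l.
have lead_eq X a : X = w c -> a = par t -> tcoef (u0 *m D) X a = 0.
  move=> -> ->; rewrite u0D tcoefB.
  have := tcoefZX 1 (w c - w t) (row t D) (w t) (par t); rewrite submK // => ->.
  have := tcoefZX 1 (w c - w s) (row s D) (w s) (par t); rewrite submK // => ->.
  by rewrite t1 -ps s1 subrr.
have hRu X a : tcoef (u0 *m D) X a != 0 -> R X a.
  move=> h; have : [/\ a \in A, lv a = p.-1, cd X = cd (w c)
      & key_le X (rk a) (w c) (rk (par t))].
    have [h1|h1] := eqVneq (tcoef ((1 *: 'X_[w c - w t]) *: row t D) X a) 0.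
      move: h; rewrite u0D tcoefB h1 sub0r oppr_eq0 =>
        /tcoefZX_neq0 [Y -> /sle].
      rewrite ls ps => -[aA la Yc hle]; split=> //; first by rewrite la.
        by rewrite cdD Yc -cdD submK.
      by rewrite -{2}(submK ws) key_le_add2l.
    case/tcoefZX_neq0: h1 => Y -> /tle.
    rewrite lt => -[aA la Yc hle]; split=> //; first by rewrite la.
      by rewrite cdD Yc -cdD submK.
    by rewrite -{2}(submK wtc) key_le_add2l.
  case=> aA la Xc hle; split=> //; apply/negPn/negP => hn.
  have : X = w c /\ a = par t.
    move: hle hn; rewrite /key_le /key_lt => /orP[->//|/andP[/eqP-> hle]].
    rewrite eqxx /= ltxx /= => hn; split=> //; apply: rk_inj => //.
    by apply/eqP; rewrite eqn_leq hle /= leqNgt.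
  by case=> eX ea; move: h; rewrite lead_eq ?eqxx.
have [|f' [v [fE hf' hred hv]]] := normal_form _ RA Rcl hRu.
  by move=> d dA ld; apply: Drow => //; move: ld; lia.
have f'0 : f' = 0.
  apply: (@reduced_ker D p) => //.
    by move=> X a /hf' /RA [aA la]; split=> //; move: la; lia.
  have : (u0 *m D) *m D = 0 by rewrite -mulmxA DD mulmx0.
  by rewrite fE mulmxDl -[v *m D *m D]mulmxA DD mulmx0 addr0.
have hvk X a : tcoef v X a != 0 ->
    [/\ a \in A, lv a = p, cd X = cd (w c) & key_lt X (rk a) (w c) (rk t)].
  move=> hX; have [/and3P[aA la0 _] [paA lpa Xc hk]] := hv _ _ hX.
  have [_ laE _] := parP aA la0; split=> //;
    first by rewrite laE lpa (ltn_predK p2).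
  move: hk; rewrite /key_lt => /orP[->//|/andP[-> hr]].
  by rewrite (rk_par aA tA) ?orbT.
exists (u0 - v); split; last first.
  by rewrite mulmxBl fE f'0 add0r subrr.
have utE : tcoef ut (w c) t = 1.
  have := tcoefZX 1 (w c - w t) (delta_mx 0 t) (w t) t.
  by rewrite submK // tcoef_delta !eqxx mulr1.
have delta0 (a : 'I_N) X b : (w a <= w c)%MM ->
    tcoef ((1 *: 'X_[w c - w a]) *: delta_mx 0 a) X b != 0 -> X = w c /\ b = a.
  move=> wa /tcoefZX_neq0 [Y ->].
  rewrite tcoef_delta; case: (b =P a) => [-> /=|_]; last by rewrite eqxx.
  by case: (Y =P w a) => [->|_]; rewrite ?eqxx // submK.
have usE : tcoef us (w c) t = 0.
  apply/eqP/negPn/negP => /(delta0 _ _ _ ws)[_ es].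
  by move: rst; rewrite es ltnn.
have vE : tcoef v (w c) t = 0.
  apply/eqP/negPn/negP => /hvk[_ _ _].
  by rewrite /key_lt ltxx eqxx ltnn.
split; first by rewrite !tcoefB utE usE vE !subr0.
move=> X b; have [h1|/hvk[bA lb Xc hk] _] := eqVneq (tcoef v X b) 0; last first.
  by split=> //; [rewrite lb | apply: key_ltW].
rewrite tcoefB h1 subr0.
have [h2|/(delta0 _ _ _ wtc)[-> ->] _] := eqVneq (tcoef ut X b) 0; last first.
  by split=> //; rewrite /key_le eqxx leqnn orbT.
rewrite tcoefB h2 sub0r oppr_eq0 => /(delta0 _ _ _ ws)[-> ->].
by split=> //; rewrite ?ls // /key_le eqxx (ltnW rst) orbT.
Qed.

(** Exactness is division with remainder: a cycle of positive level has a
    reduced remainder in the kernel of D, which vanishes by [reduced_ker]. *)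
Theorem schreyer_complex D2 : truncated 2 D2 ->
  exists D, [/\ forall c, c \in A -> (0 < lv c)%N -> leading_row c (row c D),
    forall c, ~~ ((c \in A) && (0 < lv c)%N) -> row c D = 0,
    D *m D = 0,
    forall c, (lv c <= 2)%N -> row c D = row c D2
    & forall v, (forall t, v 0 t != 0 -> t \in A /\ (0 < lv t)%N) ->
      v *m D = 0 -> exists u, v = u *m D].
Proof.
move=> h2; have ex k : exists2 D, truncated (k + 2) D &
    forall c, (lv c <= 2)%N -> row c D = row c D2.
  elim: k => [|k [D hD eD]]; first by exists D2.
  have [|D' hD' eD'] := @truncated_step (k + 2) D _ hD; first by rewrite addn2.
  exists D' => // c lc; rewrite eD' ?eD //; lia.
pose p := (\max_t lv t).+3.
have lvp t : (lv t < p)%N.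
  by have h : (lv t <= \max_t lv t)%N by [exact: leq_bigmax];
    rewrite !ltnS ltnW // ltnW.
have [D hD eD] := ex p; have [Drow D0 DD] := hD.
have Drow' c : c \in A -> (0 < lv c)%N -> leading_row c (row c D).
  by move=> cA lc; apply: Drow => //; rewrite lc; have := lvp c; lia.
exists D; split=> //.
  move=> c hc; apply: D0; apply: contra hc => /andP[-> /andP[-> _]] //.
move=> v hv vD.
pose R (X : 'X_{1..m}) (t : 'I_N) := t \in A /\ (0 < lv t)%N.
have [||X t c [tA lt] /and3P[cA lc /eqP pc] wc Y s|X t|f' [u [vE hf' hred hu]]]
    := @normal_form D p R _ _ _ v.
- by move=> c cA lc; apply: Drow' => //; move: lc; lia.
- by move=> X t [tA lt]; split=> //; rewrite lt lvp.
- have [_ lcE _] := parP cA lc.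
  have [_ cle] := Drow' _ cA lc; move=> /cle[sA ls _ _]; split=> //.
  by move: ls; rewrite lcE pc => -[<-].
- by case/tcoef_neq0 => _ h; apply: hv; apply: contraNneq h => ->;
    rewrite mcoeff0.
suff f'0 : f' = 0 by exists u; rewrite vE f'0 add0r.
apply: (@reduced_ker D p) => //.
- by move=> c cA lc; apply: Drow' => //; move: lc; lia.
- by move=> X t /hf'[tA lt]; split=> //; rewrite lt ltnW.
by move: vD; rewrite vE mulmxDl -[u *m D *m D]mulmxA DD mulmx0 addr0.
Qed.

(** Every element of the ideal generated by the level-one rows thus has an
    expression whose terms have distinct leading monomials. *)
Lemma reduce_level1 D v :
  (forall c, c \in A -> (0 < lv c)%N -> leading_row c (row c D)) -> D *m D =
    0 ->
  (forall t, v 0 t != 0 -> t \in A /\ lv t = 1%N) ->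
  exists u, [/\ u *m D = v *m D, reduced u
    & forall t, u 0 t != 0 -> t \in A /\ lv t = 1%N].
Proof.
move=> Drow DD hv.
pose R (X : 'X_{1..m}) (t : 'I_N) := t \in A /\ lv t = 1%N.
have [||X t c [tA lt] /and3P[cA lc /eqP pc] wc Y s|X t|f' [u [vE hf' hred hu]]]
    := @normal_form D 2 R _ _ _ v.
- by move=> c cA lc; apply: Drow => //; move: lc; lia.
- by move=> X t [tA ->].
- have [_ lcE _] := parP cA lc.
  have [_ cle] := Drow _ cA lc; move=> /cle[sA ls _ _]; split=> //.
  by move: ls; rewrite lcE pc lt => -[<-].
- by case/tcoef_neq0 => _ h; apply: hv; apply: contraNneq h => ->;
    rewrite mcoeff0.
exists f'; split=> //; last by move=> t /tcoef_ex[X /hf'].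
by rewrite vE mulmxDl -[u *m D *m D]mulmxA DD mulmx0 addr0.
Qed.

End Schreyer.

(** * Minimal resolutions by cancellation *)

Section GradedComplex.
Variables (K : fieldType) (m n N : nat).
Notation S := {mpoly K[m]}.
Variables (lv : 'I_N -> nat) (dg : 'I_N -> 'X_{1..n}) (bot : 'I_N)
  (cd : 'X_{1..m} -> 'X_{1..n}).
Implicit Types (A : {set 'I_N}) (D : 'M[S]_N) (I : S -> Prop).
Hypothesis cdD : {morph cd : X Y / (X + Y)%MM >-> (X + Y)%MM}.
Hypothesis mdeg_cd : forall X, mdeg (cd X) = mdeg X.
Hypothesis lv_bot : lv bot = 0%N.

(** Level 0 is to be spanned by [bot], and the complex resolves the quotient of
    the polynomial ring by I. *)
Definition graded_complex A D I :=
  [/\ forall s t, D s t != 0 -> [/\ s \in A, t \in A & lv s = (lv t).+1],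
      forall s t a, a \in msupp (D s t) -> (cd a + dg t)%MM = dg s,
      D *m D = 0,
      forall v : 'rV[S]_N,
        (forall t, v 0 t != 0 -> t \in A /\ (0 < lv t)%N) -> v *m D = 0 ->
          exists u, v = u *m D
    & forall f, I f <-> exists u : 'rV[S]_N, f = (u *m D) 0 bot].

Lemma cd_eq0 X : cd X = 0%MM -> X = 0%MM.
Proof. by move=> h; apply/eqP; rewrite -mdeg_eq0 -mdeg_cd h mdeg0. Qed.

Lemma cd0 : cd 0%MM = 0%MM.
Proof. by apply/eqP; rewrite -mdeg_eq0 mdeg_cd mdeg0. Qed.

(** A unit entry D k l splits off the exact complex generated by e_k and its
    image. After the change of basis that replaces e_l by the image of e_k, the
    remaining entries are those of E. *)
Section Cancel.
Variables (A : {set 'I_N}) (D : 'M[S]_N) (I : S -> Prop) (k l : 'I_N).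
Hypothesis botA : bot \in A.
Hypothesis cplx : graded_complex A D I.
Hypothesis ll : (0 < lv l)%N.
Hypothesis Dkl0 : (D k l)@_0%MM != 0.
Let c := (D k l)@_0%MM.
Let A' := A :\ k :\ l.
Let ci : S := c^-1%:MP.
Let E : 'M[S]_N := D - ci *: (col l D *m row k D).
Definition cancelled : 'M[S]_N :=
  \matrix_(a, b) (if (a \in A') && (b \in A') then E a b else 0).

Let Dkl_neq0 : D k l != 0.
Proof. by apply: contraNneq Dkl0 => ->; rewrite mcoeff0. Qed.

Lemma cancel_dg : dg k = dg l.
Proof.
case: cplx => _ hom _ _ _; have /hom : 0%MM \in msupp (D k l).
  by rewrite mcoeff_msupp.
by rewrite cd0 add0m.
Qed.

Let DklE : D k l = c%:MP.
Proof.
case: cplx => _ hom _ _ _; apply/mpolyP => a; rewrite mcoeffC.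
have [->|na] := eqVneq a 0%MM; first by rewrite mulr1.
rewrite mulr0; apply/eqP; rewrite mcoeff_eq0; apply/negP => /hom.
rewrite cancel_dg -[in RHS](add0m (dg l)) => /addIm /cd_eq0 a0.
by rewrite a0 eqxx in na.
Qed.

Let levels :
  [/\ k \in A, l \in A, lv k = (lv l).+1, k != l & (bot != k) && (bot != l)].
Proof.
have [sup _ _ _ _] := cplx; have [kA lA lk] := sup _ _ Dkl_neq0.
split=> //; first by apply/eqP => e; move: lk; rewrite e; lia.
apply/andP; split; apply/eqP => e; first by move: lk; rewrite -e lv_bot.
by move: ll; rewrite -e lv_bot.
Qed.

Let ciK x : ci * (D k l * x) = x.
Proof. by rewrite DklE mulrA -mpolyCM mulVf // mpolyC1 mul1r. Qed.

Let EE a b : E a b = D a b - ci * (D a l * D k b).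
Proof. by rewrite !mxE big_ord1 !mxE. Qed.

Let Eal a : E a l = 0.
Proof. by rewrite EE [D a l * _]mulrC ciK subrr. Qed.

Let Ekb b : E k b = 0.
Proof. by rewrite EE ciK subrr. Qed.

Let Enl a b : a \notin A -> E a b = 0.
Proof.
have [sup _ _ _ _] := cplx => aA; have h x : D a x = 0.
  by apply/eqP/negPn/negP => /sup[]; rewrite (negbTE aA).
by rewrite EE !h mul0r mulr0 subrr.
Qed.

Let Enr a b : b \notin A -> E a b = 0.
Proof.
have [sup _ _ _ _] := cplx => bA; have h x : D x b = 0.
  by apply/eqP/negPn/negP => /sup[_]; rewrite (negbTE bA).
by rewrite EE !h !mulr0 subrr.
Qed.

Let EEsq : E *m E = 0.
Proof.
have [_ _ DD _ _] := cplx.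
have Dl : D *m col l D = 0 by rewrite colE mulmxA DD mul0mx.
have kD : row k D *m D = 0 by rewrite -row_mul DD row0.
have kl : row k D *m col l D = 0.
  by rewrite colE mulmxA -row_mul DD row0 mul0mx.
rewrite mulmxBl !mulmxBr DD -!scalemxAl -!scalemxAr.
rewrite mulmxA Dl mul0mx scaler0 -mulmxA kD mulmx0 scaler0.
rewrite -[col l D *m row k D *m _]mulmxA [row k D *m (_ *m _)]mulmxA kl.
by rewrite mul0mx mulmx0 !scaler0 !subr0.
Qed.

Let notA' b : b \notin A' -> [\/ b \notin A, b = k | b = l].
Proof.
rewrite !inE !negb_and !negbK => /orP[/eqP->|/orP[/eqP->|h]].
- exact: Or33.
- exact: Or32.
- exact: Or31.
Qed.

Let cancelled_sq : cancelled *m cancelled = 0.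
Proof.
apply/matrixP => a d; rewrite [in RHS]mxE mxE.
have [aA'|aA'] := boolP (a \in A'); last first.
  by rewrite big1 // => b _; rewrite mxE (negbTE aA') mul0r.
have [dA'|dA'] := boolP (d \in A'); last first.
  by rewrite big1 // => b _; rewrite [X in _ * X]mxE (negbTE dA') andbF mulr0.
move/matrixP/(_ a d): EEsq; rewrite [in RHS]mxE mxE => h; rewrite -[RHS]h.
apply: eq_bigr => b _; rewrite ![cancelled _ _]mxE aA' dA' andbT /=.
have [bA'|/notA'[bA|->|->]] := boolP (b \in A') => //.
- by rewrite (Enr _ bA) !mul0r.
- by rewrite Ekb !mulr0.
- by rewrite Eal !mul0r.
Qed.

Let mul_cancelled (u : 'rV[S]_N) b : b \in A' -> u 0 l = 0 ->
  (u *m cancelled) 0 b = (u *m D) 0 b - ci * ((u *m D) 0 l * D k b).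
Proof.
move=> bA' ul; transitivity ((u *m E) 0 b).
  rewrite !mxE; apply: eq_bigr => a _; rewrite [cancelled _ _]mxE bA' andbT.
  case: ifPn => [//|/notA'[aA|->|->]]; last by rewrite ul !mul0r.
    by rewrite Enl.
  by rewrite Ekb.
rewrite mulmxBr -scalemxAr mulmxA !mxE big_ord1; congr (_ - _ * (_ * _)).
  by rewrite !mxE; apply: eq_bigr => a _; rewrite !mxE.
by rewrite !mxE.
Qed.

Let transfer (u : 'rV[S]_N) : (u *m D) 0 l = 0 ->
  exists u' : 'rV[S]_N,
    forall b, b \in A' -> (u' *m cancelled) 0 b = (u *m D) 0 b.
Proof.
have [_ _ DD _ _] := cplx => ul.
pose u' : 'rV[S]_N := u - (ci * u 0 l) *: row k D.
have u'D : u' *m D = u *m D.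
  by rewrite mulmxBl -scalemxAl -row_mul DD row0 scaler0 subr0.
have u'l : u' 0 l = 0 by rewrite !mxE -mulrA [u 0 l * _]mulrC ciK subrr.
by exists u' => b bA'; rewrite mul_cancelled // u'D ul mul0r mulr0 subr0.
Qed.

(** A cycle v of the new complex lifts to the cycle v1 of the old one by adding
    the multiple of e_k which makes the coordinate at l vanish. *)
Lemma cancelled_complex : graded_complex A' cancelled I.
Proof.
have [kA lA lk nkl /andP[nbk nbl]] := levels.
have [sup hom DD exa img] := cplx.
have A'A a : a \in A' -> a \in A by rewrite !inE => /and3P[].
split.
- move=> s t; rewrite mxE; case: ifP => [/andP[sA' tA']|_];
    last by rewrite eqxx.
  move=> h; split=> //; have [h1|/sup[]//] := eqVneq (D s t) 0.
  move: h; rewrite EE h1 sub0r oppr_eq0 => h.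
  have /sup[_ _ ls] : D s l != 0.
    by apply: contraNneq h => ->; rewrite mul0r mulr0.
  have /sup[_ _ lt] : D k t != 0.
    by apply: contraNneq h => ->; rewrite !mulr0.
  by rewrite ls -lk lt.
- move=> s t a; rewrite mxE; case: ifP => _; last by rewrite msupp0.
  rewrite EE => /msuppB_le; rewrite mem_cat => /orP[/hom//|].
  rewrite mul_mpolyC => /msuppZ_le.
  case/msuppM_le/allpairsP => -[a1 a2] /= [/hom h1 /hom h2 ->].
  by rewrite cdD -addmA h2 cancel_dg.
- exact: cancelled_sq.
- move=> v hv vD.
  have vl : v 0 l = 0.
    by apply/eqP/negPn/negP => /hv[]; rewrite !inE eqxx.
  have vk : v 0 k = 0.
    by apply/eqP/negPn/negP => /hv[]; rewrite !inE eqxx andbF.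
  pose t := - (ci * (v *m D) 0 l).
  pose v1 : 'rV[S]_N := v + t *: delta_mx 0 k.
  have v1D b : (v1 *m D) 0 b = (v *m D) 0 b + t * D k b.
    by rewrite mulmxDl -scalemxAl -rowE !mxE.
  have v1l : (v1 *m D) 0 l = 0.
    by rewrite v1D mulNr -mulrA [_ * D k l]mulrC ciK subrr.
  have v1A b : b != k -> (v1 *m D) 0 b = 0.
    move=> nbk'; have [bA'|/notA'[bA|e|->//]] := boolP (b \in A').
    - have := mul_cancelled bA' vl; rewrite vD mxE => /esym h.
      by rewrite v1D /t mulNr -mulrA.
    - rewrite mxE big1 // => a _; have [->|/sup[_]] := eqVneq (D a b) 0.
        by rewrite mulr0.
      by rewrite (negbTE bA).
    - by rewrite e eqxx in nbk'.
  (* only the coordinate k is left, and D D = 0 with D k l a unit kills it *)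
  have v1k : (v1 *m D) 0 k = 0.
    have : (v1 *m D *m D) 0 l = 0 by rewrite -mulmxA DD mulmx0 mxE.
    rewrite mxE (bigD1 k) //= big1 ?addr0; last first.
      by move=> b nb; rewrite v1A // mul0r.
    by move/eqP; rewrite mulf_eq0 (negbTE Dkl_neq0) orbF => /eqP.
  have [||u uE] := exa v1.
  + move=> b; have [->|nb] := eqVneq b k; first by rewrite lk.
    rewrite !mxE (negbTE nb) andbF mulr0 addr0 => /hv[bA' lb].
    by split=> //; apply: A'A.
  + by apply/rowP => b; rewrite [RHS]mxE; have [->|/v1A] := eqVneq b k.
  have [|u' hu'] := @transfer u.
    by rewrite -uE !mxE vl (eq_sym l) (negbTE nkl) andbF mulr0 addr0.
  exists u'; apply/rowP => b; have [bA'|bA'] := boolP (b \in A').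
    rewrite hu' // -uE !mxE; have -> : (b == k) = false.
      by apply/negbTE; move: bA'; rewrite !inE => /and3P[].
    by rewrite andbF mulr0 addr0.
  rewrite mxE big1 => [|a _]; last by rewrite mxE (negbTE bA') andbF mulr0.
  by apply/eqP/negPn/negP => /hv[]; rewrite (negbTE bA').
move=> f; rewrite img.
have botA' : bot \in A' by rewrite !inE nbk nbl.
have Dkb : D k bot = 0.
  by apply/eqP/negPn/negP => /sup[_ _]; rewrite lk lv_bot => -[e]; move: ll;
    rewrite e.
split=> [[u fE]|[u fE]].
  pose u0 : 'rV[S]_N := \row_t (if lv t == 1%N then u 0 t else 0).
  have [|u' hu'] := @transfer u0.
    rewrite mxE big1 // => a _; have [->|/sup[_ _ la]] := eqVneq (D a l) 0.
      by rewrite mulr0.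
    by rewrite mxE la eqSS (gtn_eqF ll) mul0r.
  exists u'; rewrite hu' // fE !mxE; apply: eq_bigr => a _; rewrite mxE.
  have [->|/sup[_ _ ->]] := eqVneq (D a bot) 0; first by rewrite !mulr0.
  by rewrite lv_bot.
exists (\row_t (if t \in A' then u 0 t else 0)); rewrite fE [LHS]mxE [RHS]mxE.
apply: eq_bigr => a _; rewrite [cancelled _ _]mxE [X in _ = X * _]mxE botA'
  andbT.
case: ifP => _; last by rewrite mul0r mulr0.
by rewrite EE Dkb !mulr0 subr0.
Qed.

End Cancel.

Definition minimal D := forall s t, (0 < lv t)%N -> (D s t)@_0%MM = 0.

(** The two elements cancelled in a step have equal multidegree, whence the
    last claim. *)
Theorem minimal_complex A D I : bot \in A -> graded_complex A D I ->
  exists A' D', [/\ A' \subset A, graded_complex A' D' I, minimal D'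
    & forall t, t \in A -> (forall s, s \in A -> dg s = dg t -> s = t) ->
        t \in A'].
Proof.
elim: {A}_.+1 {-2}A (ltnSn #|A|) D => // q IHq A ltA D botA cplx.
have [/existsP[k /existsP[l /andP[ll Dkl]]]|hno] :=
  boolP [exists k, exists l, (0 < lv l)%N && ((D k l)@_0%MM != 0)]; last first.
  exists A, D; split=> // s t lt; apply/eqP/negPn/negP => h; case/negP: hno.
  by apply/existsP; exists s; apply/existsP; exists t; rewrite lt.
have [sup hom _ _ _] := cplx.
have /sup[kA lA lk] : D k l != 0.
  by apply: contraNneq Dkl => ->; rewrite mcoeff0.
have nkl : k != l by apply/eqP => e; move: lk; rewrite e; lia.
have dkl := cancel_dg cplx Dkl.
have cplx' := cancelled_complex botA cplx ll Dkl.
have sA' : A :\ k :\ l \subset A by rewrite !subDset; apply/subsetP => x;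
  rewrite !inE => ->; rewrite !orbT.
have [||A1 [D1 [s1 c1 m1 u1]]] := IHq _ _ _ _ cplx'.
- rewrite ltnS in ltA; apply: leq_trans ltA; apply: proper_card.
  by apply/properP; split=> //; exists k; rewrite // !inE eqxx andbF.
- rewrite !inE botA andbT; apply/andP; split; apply/eqP => e.
    by move: ll; rewrite -e lv_bot.
  by move: lk; rewrite -e lv_bot.
exists A1, D1; split=> //; first exact: subset_trans s1 sA'.
move=> t tA tu; apply: u1; last by move=> s /(subsetP sA'); apply: tu.
rewrite !inE tA andbT; apply/andP; split; apply/eqP => e.
  by have := tu _ kA; rewrite e dkl => /(_ erefl) e'; rewrite e' eqxx in nkl.
by have := tu _ lA; rewrite e dkl => /(_ erefl) e'; rewrite e' eqxx in nkl.
Qed.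

(** The layers of the square matrix, in the form of a sequence of matrices.
    The homological degree over I is one less than the level. *)
Section ToResolution.
Variables (A : {set 'I_N}) (D : 'M[S]_N) (I : S -> Prop).
Hypothesis lv0 : forall t, t \in A -> lv t = 0%N -> t = bot.
Hypothesis cplx : graded_complex A D I.
Hypothesis Dmin : minimal D.
Hypothesis dg_bot : dg bot = 0%MM.

Definition layer i := [set t in A | lv t == i.+1].
Definition inc i : 'M[S]_(#|layer i|, N) :=
  \matrix_(k, t) (t == enum_val k)%:R.

Let incE i p (M : 'M[S]_(N, p)) k j : (inc i *m M) k j = M (enum_val k) j.
Proof.
rewrite mxE (bigD1 (enum_val k)) //= mxE eqxx mul1r big1 ?addr0 // => t nt.
by rewrite mxE (negbTE nt) mul0r.
Qed.

Let mul_incT i p (M : 'M[S]_(p, N)) j k :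
  (M *m (inc i)^T) j k = M j (enum_val k).
Proof.
rewrite mxE (bigD1 (enum_val k)) //= !mxE eqxx mulr1 big1 ?addr0 // => t nt.
by rewrite !mxE (negbTE nt) mulr0.
Qed.

Let inc_incT i : inc i *m (inc i)^T = 1%:M.
Proof.
apply/matrixP => k l; rewrite mul_incT !mxE eq_sym.
by rewrite (inj_eq enum_val_inj).
Qed.

Let incT_inc i s t :
  ((inc i)^T *m inc i) s t = ((s == t) && (s \in layer i))%:R.
Proof.
have [sl|sl] := boolP (s \in layer i); last first.
  rewrite andbF mxE big1 // => k _; rewrite !mxE.
  case: eqP => [e|_]; last by rewrite mul0r.
  by case/negP: sl; rewrite e enum_valP.
rewrite mxE (bigD1 (enum_rank_in sl s)) //= !mxE enum_rankK_in // eqxx mul1r.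
rewrite big1 ?addr0 ?andbT 1?eq_sym // => k nk; rewrite !mxE.
case: eqP => [e|_]; last by rewrite mul0r.
by case/eqP: nk; apply: enum_val_inj; rewrite enum_rankK_in.
Qed.

Let incTinc_l i p (M : 'M[S]_(N, p)) :
  (forall s j, M s j != 0 -> s \in layer i) -> (inc i)^T *m inc i *m M = M.
Proof.
move=> h; apply/matrixP => s j; rewrite mxE (bigD1 s) //= incT_inc eqxx /=.
rewrite big1 ?addr0 => [|t nt];
  last by rewrite incT_inc eq_sym (negbTE nt) mul0r.
have [->|/h->] := eqVneq (M s j) 0; first by rewrite mulr0.
by rewrite mul1r.
Qed.

Let incTinc_r i p (M : 'M[S]_(p, N)) :
  (forall j s, M j s != 0 -> s \in layer i) -> M *m (inc i)^T *m inc i = M.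
Proof.
move=> h; rewrite -mulmxA; apply/matrixP => j s;
  rewrite mxE (bigD1 s) //= incT_inc eqxx /=.
rewrite big1 ?addr0 => [|t nt]; last by rewrite incT_inc (negbTE nt) mulr0.
have [->|/h->] := eqVneq (M j s) 0; first by rewrite mul0r.
by rewrite mulr1.
Qed.

Let diff i := inc i.+1 *m D *m (inc i)^T.
Let aug := inc 0 *m D *m (delta_mx bot 0 : 'cV_N).

Let layerP i t : t \in layer i -> t \in A /\ lv t = i.+1.
Proof. by rewrite inE => /andP[-> /eqP->]. Qed.

Let diff_inc i : diff i *m inc i = inc i.+1 *m D.
Proof.
have [sup _ _ _ _] := cplx.
apply: incTinc_r => j s; rewrite incE => /sup[_ sA].
have [_ ->] := layerP (enum_valP j) => -[ls].
by rewrite inE sA -ls eqxx.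
Qed.

Let incT_diff i : (inc i.+1)^T *m diff i = D *m (inc i)^T.
Proof.
have [sup _ _ _ _] := cplx.
rewrite /diff !mulmxA -[_ *m D *m _]mulmxA; apply: incTinc_l => s j.
rewrite mul_incT => /sup[sA _ ls]; have [_ lj] := layerP (enum_valP j).
by rewrite inE sA ls lj eqxx.
Qed.

Let aug_E p (u : 'M[S]_(p, N)) k :
  (u *m (delta_mx bot 0 : 'cV[S]_N)) k 0 = u k bot.
Proof. by rewrite -colE mxE. Qed.

Let augE k j : aug k j = D (enum_val k) bot.
Proof. by rewrite ord1 /aug aug_E incE. Qed.

Let diffE i k l : diff i k l = D (enum_val k) (enum_val l).
Proof. by rewrite /diff mul_incT incE. Qed.

Let exact_inc i p (v : 'M[S]_(1, #|layer i|)) (M : 'M[S]_(_, p)) :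
  (v *m M = 0 -> v *m inc i *m D = 0) ->
  v *m M = 0 -> exists u : 'rV_#|layer i.+1|, v = u *m diff i.
Proof.
have [sup _ DD exa _] := cplx => h /h h0.
have [t|u uE] := exa (v *m inc i) _ h0.
  move=> ht; suff : t \in layer i by case/layerP => -> ->.
  apply: contraNT ht => nt; rewrite mxE big1 // => k _; rewrite mxE.
  case: eqP => [e|_]; last by rewrite mulr0.
  by case/negP: nt; rewrite e enum_valP.
exists (u *m (inc i.+1)^T); rewrite -mulmxA incT_diff mulmxA -uE.
by rewrite -mulmxA inc_incT mulmx1.
Qed.

Fact res_aug_homog k a :
  a \in msupp (aug k 0) -> mdeg a = mdeg (dg (enum_val k)).
Proof.
have [_ hom _ _ _] := cplx.
by rewrite augE => /hom <-; rewrite dg_bot addm0 mdeg_cd.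
Qed.

Fact res_diff_homog i k l a : a \in msupp (diff i k l) ->
  (mdeg a + mdeg (dg (enum_val l)))%N = mdeg (dg (enum_val k)).
Proof.
have [_ hom _ _ _] := cplx.
by rewrite diffE => /hom <-; rewrite mdegD mdeg_cd.
Qed.

Fact res_aug_image f : I f <-> exists v : 'rV_#|layer 0|, f = (v *m aug) 0 0.
Proof.
have [sup _ _ _ img] := cplx; rewrite img; split=> -[u ->].
  exists (u *m (inc 0)^T); rewrite /aug !mulmxA aug_E.
  rewrite -![_ *m (inc 0)^T *m _]mulmxA -[_ *m _ *m D]mulmxA.
  rewrite !mxE; apply: eq_bigr => t _; congr (_ * _).
  rewrite mxE (bigD1 t) //= incT_inc eqxx /=.
  rewrite big1 ?addr0 => [|s ns];
    last by rewrite incT_inc eq_sym (negbTE ns) mul0r.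
  have [->|/sup[tA _ lt]] := eqVneq (D t bot) 0; first by rewrite mulr0.
  by rewrite inE tA lt lv_bot eqxx mul1r.
by exists (u *m inc 0); rewrite /aug !mulmxA aug_E.
Qed.

Fact res_exact0 (v : 'rV_#|layer 0|) :
  v *m aug = 0 <-> exists u : 'rV_#|layer 1|, v = u *m diff 0.
Proof.
have [sup _ DD exa _] := cplx; split=> [|[u ->]]; last first.
  rewrite /aug -mulmxA [diff 0 *m _]mulmxA [diff 0 *m _]mulmxA diff_inc.
  by rewrite -[inc 1 *m D *m D]mulmxA DD mulmx0 mul0mx mulmx0.
apply: exact_inc => h; apply/rowP => t; rewrite [RHS]mxE.
have [->|nt] := eqVneq t bot.
  by move/matrixP/(_ 0 0): h; rewrite /aug !mulmxA aug_E => ->; rewrite mxE.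
rewrite -mulmxA mxE big1 // => k _; rewrite incE.
have [->|/sup[_ tA]] := eqVneq (D (enum_val k) t) 0; first by rewrite mulr0.
have [_ ->] := layerP (enum_valP k) => -[/esym lt].
by rewrite (lv0 tA lt) eqxx in nt.
Qed.

Fact res_exact i (v : 'rV_#|layer i.+1|) :
  v *m diff i = 0 <-> exists u : 'rV_#|layer i.+2|, v = u *m diff i.+1.
Proof.
have [sup _ DD exa _] := cplx; split=> [|[u ->]]; last first.
  have -> : u *m diff i.+1 *m diff i =
      u *m (diff i.+1 *m inc i.+1 *m D *m (inc i)^T) by rewrite /diff !mulmxA.
  by rewrite diff_inc -[_ *m D *m D]mulmxA DD mulmx0 mul0mx mulmx0.
apply: exact_inc => h.
by rewrite -mulmxA -diff_inc mulmxA h mul0mx.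
Qed.

Fact res_minimal i k l : (diff i k l)@_0%MM = 0.
Proof. by rewrite diffE; apply: Dmin; have [_ ->] := layerP (enum_valP l). Qed.

Definition resolution : min_graded_res I :=
  @MinGradedRes K m I (fun i => #|layer i|)
    (fun i (k : 'I_#|layer i|) => mdeg (dg (enum_val k))) aug diff
    res_aug_homog res_diff_homog res_aug_image res_exact0 res_exact res_minimal.

Lemma betti_resolution i j : betti resolution i j != 0%N <->
  exists t, [/\ t \in A, lv t = i.+1 & mdeg (dg t) = j].
Proof.
rewrite -lt0n; split=> [/card_gt0P[/= k]|[t [tA lt tj]]].
  rewrite inE /= => /eqP hj; exists (enum_val k).
  by have [kA ->] := layerP (enum_valP k).
have tl : t \in layer i by rewrite inE tA lt eqxx.
apply/card_gt0P => /=; exists (enum_rank_in tl t).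
by rewrite inE /= enum_rankK_in // tj.
Qed.

End ToResolution.
End GradedComplex.

(** * The combinatorial frame *)

(** The pair (i,j) in B stands for the monomial x_i y_j, that is, for an edge
    of a bipartite graph on the variables. *)
Section Symbols.
Local Open Scope nat_scope.

Variables (n : nat) (B : rel 'I_n).
Notation edge := ('I_n * 'I_n)%type.
Notation var := 'I_(n + n).
Implicit Types (M : {set edge}) (U Z : {set var}) (p q : edge) (u v : var).

Hypothesis B_lt : forall i j, B i j -> (i < j)%N.
Hypothesis B_up : forall i j k, B i j -> B i k -> (j < k)%N -> B j k.
Hypothesis B_down : forall i j k, B j i -> B k i -> (j < k)%N -> B j k.

(** This property makes (i,j) a bisimplicial edge of the bipartite graph once
    all lexicographically smaller edges are removed. *)
Lemma B_corner i a j k :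
  B i j -> B i k -> B a j -> (i < a)%N -> (j < k)%N -> B a k.
Proof.
move=> ij ik aj ia jk; have ia' := B_down ij aj ia.
apply: (B_up ia' ik); have := B_lt aj; lia.
Qed.

(** Induced matchings of the bipartite graph. *)
Definition matching M :=
  [forall p in M, B p.1 p.2] &&
  [forall p in M, forall q in M, B p.1 q.2 ==> (p == q)].

Lemma matchingP M : reflect
  ((forall p, p \in M -> B p.1 p.2) /\
   (forall p q, p \in M -> q \in M -> B p.1 q.2 -> p = q)) (matching M).
Proof.
apply: (iffP andP) => [[/forall_inP h1 /forall_inP h2]|[h1 h2]]; split=> //.
- move=> p q pM qM hB; apply/eqP.
  by have /forall_inP/(_ q qM)/implyP/(_ hB) := h2 p pM.
- by apply/forall_inP.
- apply/forall_inP => p pM; apply/forall_inP => q qM; apply/implyP => hB.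
  by apply/eqP/h2.
Qed.

(** The variables contributed to colon ideals by the edges of M. *)
Definition nbr M u := match split u with
  | inl a => [exists p in M, (p.1 < a)%N && B a p.2]
  | inr k => [exists p in M, (p.2 < k)%N && B p.1 k] end.

Lemma nbr_x M (a : 'I_n) :
  reflect (exists p, [/\ p \in M, (p.1 < a)%N & B a p.2]) (nbr M (lshift n a)).
Proof.
rewrite /nbr (unsplitK (inl a));
  apply: (iffP exists_inP) => [[p pM /andP[h1 h2]]|[p [pM h1 h2]]].
  by exists p.
by exists p; rewrite ?h1.
Qed.

Lemma nbr_y M (k : 'I_n) :
  reflect (exists p, [/\ p \in M, (p.2 < k)%N & B p.1 k]) (nbr M (rshift n k)).
Proof.
rewrite /nbr (unsplitK (inr k));
  apply: (iffP exists_inP) => [[p pM /andP[h1 h2]]|[p [pM h1 h2]]].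
  by exists p.
by exists p; rewrite ?h1.
Qed.

Lemma var_case u : (exists a, u = lshift n a) \/ (exists k, u = rshift n k).
Proof. by case: (splitP u) => j h; [left|right]; exists j; apply: val_inj. Qed.

Lemma nbr_sub M M' u : M \subset M' -> nbr M u -> nbr M' u.
Proof.
move=> /subsetP sM; have [[a ->]|[k ->]] := var_case u.
  by case/nbr_x => p [/sM pM h1 h2]; apply/nbr_x; exists p.
by case/nbr_y => p [/sM pM h1 h2]; apply/nbr_y; exists p.
Qed.

Lemma matching_sub M M' : M \subset M' -> matching M' -> matching M.
Proof.
move=> /subsetP sM /matchingP[h1 h2]; apply/matchingP.
by split=> [p /sM/h1|p q /sM pM /sM qM] //; apply: h2.
Qed.

(** A basis element is built by choosing first the edges of M in increasing
    lexicographic order and then the variables of U in decreasing order. *)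
Definition symbol := ({set edge} * {set var})%type.
Implicit Types s t : symbol.

Definition valid t := matching t.1 && [forall u in t.2, nbr t.1 u].

Definition vars p : {set var} := [set lshift n p.1; rshift n p.2].
Definition msupport M : {set var} := \bigcup_(p in M) vars p.
Definition support t : {set var} := msupport t.1 :|: t.2.

Lemma msupport_x M (a : 'I_n) :
  reflect (exists2 p, p \in M & p.1 = a) (lshift n a \in msupport M).
Proof.
apply: (iffP bigcupP) => [[p pM]|[p pM <-]]; last by exists p; rewrite ?set21.
rewrite in_set2 eq_lrshift orbF => /eqP/lshift_inj ->; by exists p.
Qed.

Lemma msupport_y M (k : 'I_n) :
  reflect (exists2 p, p \in M & p.2 = k) (rshift n k \in msupport M).
Proof.
apply: (iffP bigcupP) => [[p pM]|[p pM <-]]; last by exists p; rewrite ?set22.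
rewrite in_set2 eq_rlshift => /eqP/rshift_inj ->; by exists p.
Qed.

Lemma nbr_notin M u : matching M -> nbr M u -> u \notin msupport M.
Proof.
move=> /matchingP[h1 h2] hu; apply/negP; move: hu.
have [[a ->]|[k ->]] := var_case u.
  case/nbr_x => p [pM h3 h4] /msupport_x[q qM e].
  by rewrite -e in h3 h4; move: h3; rewrite (h2 _ _ qM pM h4) ltnn.
case/nbr_y => p [pM h3 h4] /msupport_y[q qM e].
by rewrite -e in h3 h4; move: h3; rewrite (h2 _ _ pM qM h4) ltnn.
Qed.

Lemma matching_card M : matching M -> #|msupport M| = (2 * #|M|)%N.
Proof.
move=> /matchingP[h1 h2].
have -> : msupport M =
    [set lshift n p.1 | p in M] :|: [set rshift n p.2 | p in M].
  apply/setP => u; rewrite in_setU; have [[a ->]|[k ->]] := var_case u.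
    apply/msupport_x/orP => [[p pM <-]|[]/imsetP[p pM e]].
    - by left; apply: imset_f.
    - by exists p => //; apply/esym/(@lshift_inj n n).
    - by move/eqP: e; rewrite eq_lrshift.
  apply/msupport_y/orP => [[p pM <-]|[]/imsetP[p pM e]].
  - by right; apply: imset_f.
  - by move/eqP: e; rewrite eq_rlshift.
  - by exists p => //; apply/esym/(@rshift_inj n n).
rewrite cardsU !card_in_imset; last 2 first.
- move=> p q pM qM /rshift_inj e; apply: h2 => //.
  by rewrite -e; apply: h1.
- move=> p q pM qM /lshift_inj e; apply: h2 => //.
  by rewrite e; apply: h1.
rewrite mul2n -addnn (_ : _ :&: _ = set0) ?cards0 ?subn0 //.
apply/setP => u; rewrite !inE;
  apply/negP => /andP[/imsetP[p _ ->] /imsetP[q _ /eqP]].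
by rewrite eq_lrshift.
Qed.

(** An integer whose order is the lexicographic order on pairs. *)
Definition code p := (p.1 * n + p.2)%N.

Lemma code_lt p q : (code p < code q)%N =
  (p.1 < q.1)%N || ((p.1 == q.1) && (p.2 < q.2)%N).
Proof.
case: p q => [a b] [c d]; rewrite /code /=.
have hb := ltn_ord b; have hd := ltn_ord d.
apply/idP/orP => [h|[h|/andP[/eqP-> h]]]; last by rewrite ltn_add2l.
  case: (ltngtP a c) => h'; [by left | | right].
    suff : (c * n + d < a * n + b)%N by lia.
    have : (c.+1 * n <= a * n)%N by rewrite leq_mul2r h' orbT.
    by rewrite mulSn; lia.
  have e : a = c by apply: val_inj.
  by move: h; rewrite e eqxx ltn_add2l.
have : (a.+1 * n <= c * n)%N by rewrite leq_mul2r h orbT.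
by rewrite mulSn; lia.
Qed.

Lemma code_bound p : (code p < n * n)%N.
Proof.
rewrite /code; have h1 := ltn_ord p.1; have h2 := ltn_ord p.2.
have : (p.1.+1 * n <= n * n)%N by rewrite leq_mul2r h1 orbT.
by rewrite mulSn; lia.
Qed.

Lemma code_inj : injective code.
Proof.
move=> p q e; have := code_lt p q; have := code_lt q p.
rewrite e ltnn => /esym/norP[h1 h2] /esym/norP[h3 h4].
have e1 : p.1 = q.1 by apply: ord_inj; lia.
move: h2 h4; rewrite e1 eqxx /= => h2 h4.
by rewrite [p]surjective_pairing [q]surjective_pairing e1; congr (_, _);
  apply: ord_inj; lia.
Qed.

(** The symbol before the last choice. *)
Definition parent t : symbol :=
  if [pick u in t.2] is Some u0 then
    (t.1, t.2 :\ [arg min_(u < u0 in t.2) (u : nat)])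
  else if [pick p in t.1] is Some p0 then
    (t.1 :\ [arg max_(p > p0 in t.1) code p], set0) else t.

(** The place of the last choice among its alternatives: variables precede
    edges, and among edges the lexicographically larger ones come first. *)
Definition position t : nat :=
  if [pick u in t.2] is Some u0 then [arg min_(u < u0 in t.2) (u : nat)]
  else if [pick p in t.1] is Some p0 then
    (n + n + (n * n - code [arg max_(p > p0 in t.1) code p]))%N else 0.

Definition level t := (#|t.1| + #|t.2|)%N.

Definition add_var M U u := u \notin U /\ (forall v, v \in U -> (u < v)%N).
Definition add_edge M p :=
  p \notin M /\ (forall q, q \in M -> (code q < code p)%N).

Lemma arg_min_add M U u u0 : add_var M U u -> u0 \in u |: U ->
  [arg min_(v < u0 in u |: U) (v : nat)] = u.
Proof.
move=> [uU hu] h0; case: arg_minnP => // v; rewrite in_setU1 => /orP[/eqP//|vU].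
move=> /(_ u); rewrite setU11 => /(_ isT) h1.
by have := leq_ltn_trans h1 (hu _ vU); rewrite ltnn.
Qed.

Lemma arg_max_add M p p0 : add_edge M p -> p0 \in p |: M ->
  [arg max_(q > p0 in p |: M) code q] = p.
Proof.
move=> [pM hp] h0; case: arg_maxnP => // q; rewrite in_setU1 => /orP[/eqP//|qM].
move=> /(_ p); rewrite setU11 => /(_ isT) h1.
by have := leq_ltn_trans h1 (hp _ qM); rewrite ltnn.
Qed.

Lemma parent_var M U u : add_var M U u ->
  parent (M, u |: U) = (M, U) /\ position (M, u |: U) = u.
Proof.
move=> h; rewrite /parent /position; case: pickP => [u0 /= h0|/(_ u)];
  last by rewrite setU11.
by rewrite (arg_min_add h h0) setU1K //; case: h.
Qed.

Lemma parent_edge M p : add_edge M p ->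
  parent (p |: M, set0) = (M, set0) /\
  position (p |: M, set0) = (n + n + (n * n - code p))%N.
Proof.
move=> h; rewrite /parent /position; case: pickP => [u0 /=|_];
  first by rewrite inE.
case: pickP => [p0 /= h0|/(_ p)]; last by rewrite setU11.
by rewrite (arg_max_add h h0) setU1K //; case: h.
Qed.

Variant symbol_spec : symbol -> Prop :=
 | SymRoot : symbol_spec (set0, set0)
 | SymVar M U u of add_var M U u : symbol_spec (M, u |: U)
 | SymEdge M p of add_edge M p : symbol_spec (p |: M, set0).

Lemma symbolP t : symbol_spec t.
Proof.
case: t => M U; have [->|/set0Pn[u0 h0]] := eqVneq U set0.
  have [->|/set0Pn[p0 h0]] := eqVneq M set0; first exact: SymRoot.
  have [p pM hp] := arg_maxnP code h0.
  rewrite -(setD1K pM); apply: SymEdge; split; first by rewrite !inE eqxx.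
  move=> q; rewrite !inE => /andP[nq qM];
    rewrite ltn_neqAle (hp _ qM : code q <= code p) andbT.
  by apply: contraNneq nq => /code_inj ->.
have [u uU hu] := arg_minnP (fun v : var => v : nat) h0.
rewrite -(setD1K uU); apply: SymVar; split; first by rewrite !inE eqxx.
move=> v; rewrite !inE => /andP[nv vU];
  rewrite ltn_neqAle (hu _ vU : u <= v) andbT.
by apply: contraNneq nv => /ord_inj ->.
Qed.

Lemma level0 t : level t = 0%N -> t = (set0, set0).
Proof.
case: t => M U /eqP; rewrite /level /= addn_eq0 !cards_eq0.
by case/andP => /eqP-> /eqP->.
Qed.

Lemma level_root : level (set0, set0) = 0%N.
Proof. by rewrite /level !cards0. Qed.

Lemma level_var M U u : add_var M U u -> level (M, u |: U) = (level (M, U)).+1.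
Proof. by case=> uU _; rewrite /level /= cardsU1 uU add1n addnS. Qed.

Lemma level_edge M p :
  add_edge M p -> level (p |: M, set0) = (level (M, set0)).+1.
Proof. by case=> pM _; rewrite /level /= cardsU1 pM add1n addSn. Qed.

Lemma valid_var M U u : valid (M, u |: U) = valid (M, U) && nbr M u.
Proof.
rewrite /valid /= -andbA; congr (_ && _);
  apply/forall_inP/andP => [h|[/forall_inP h hu] v].
  split; last by apply: h; rewrite setU11.
  by apply/forall_inP => v vU; apply: h; rewrite setU1r.
by rewrite in_setU1 => /orP[/eqP->|/h].
Qed.

Lemma valid_edges M : valid (M, set0) = matching M.
Proof.
by rewrite /valid /=; case: (matching M) => //=; apply/forall_inP => u;
  rewrite inE.
Qed.

Lemma valid_edge M p : valid (p |: M, set0) -> valid (M, set0).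
Proof. by rewrite !valid_edges; apply: matching_sub; apply: subsetUr. Qed.

Lemma parent_props t : valid t -> (0 < level t)%N ->
  [/\ valid (parent t), level t = (level (parent t)).+1 &
    support (parent t) \subset support t].
Proof.
case: (symbolP t) => [|M U u h|M p h]; first by rewrite level_root.
  rewrite valid_var => /andP[v _] _; have [-> _] := parent_var h.
  by split=> //; [apply: level_var | rewrite /support /= setUCA subsetUr].
move=> /valid_edge v _; have [-> _] := parent_edge h.
split=> //; first exact: level_edge.
by rewrite /support /= !setU0 /msupport bigcup_setU subsetUr.
Qed.

Definition base := (n + n + n * n).+2.

Lemma position_bound t : ((position t).+1 < base)%N.
Proof.
rewrite /base ltnS; case: (symbolP t) => [|M U u h|M p h].
- rewrite /position; case: pickP => [u|_]; first by rewrite inE.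
  by case: pickP => [u|_] //; rewrite inE.
- by have [_ ->] := parent_var h; have := ltn_ord u; lia.
- by have [_ ->] := parent_edge h; lia.
Qed.

(** Reading the positions of the successive choices as digits compares symbols
    by their first differing choice. Digits are nonzero, so that symbols of
    different levels have different ranks. *)
Fixpoint rank_rec k t : nat :=
  if k is k'.+1 then (rank_rec k' (parent t) * base + (position t).+1)%N else 0.
Definition rank t := rank_rec (level t) t.

Lemma rankE t : valid t -> (0 < level t)%N ->
  rank t = (rank (parent t) * base + (position t).+1)%N.
Proof.
move=> vt lt; have [_ e _] := parent_props vt lt.
by rewrite /rank {1}e /=.
Qed.

Lemma rank_parent s t : valid s -> valid t -> (0 < level s)%N ->
  (0 < level t)%N -> (rank (parent s) < rank (parent t))%N ->
  (rank s < rank t)%N.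
Proof.
move=> vs vt ls lt h; rewrite (rankE vs ls) (rankE vt lt).
have := position_bound s; have :
  ((rank (parent s)).+1 * base <= rank (parent t) * base)%N.
  by rewrite leq_mul2r h orbT.
by rewrite mulSn; lia.
Qed.

Lemma rank_sibling s t : valid s -> valid t -> (0 < level s)%N ->
  (0 < level t)%N -> parent s = parent t ->
  (rank s < rank t)%N = (position s < position t)%N.
Proof.
by move=> vs vt ls lt h; rewrite (rankE vs ls) (rankE vt lt) h ltn_add2l ltnS.
Qed.

Lemma sibling_inj s t : (0 < level s)%N -> (0 < level t)%N ->
  parent s = parent t -> position s = position t -> s = t.
Proof.
case: (symbolP s) => [|M U u h|M p h]; first by rewrite level_root.
  move=> _; have [-> ->] := parent_var h.
  case: (symbolP t) => [|M' U' u' h'|M' p' h']; first by rewrite level_root.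
    by have [-> ->] := parent_var h' => _ [-> ->] /ord_inj ->.
  have [_ ->] := parent_edge h'; have := ltn_ord u => h1 _ _ e.
  by move: h1; rewrite e; lia.
move=> _; have [-> ->] := parent_edge h.
case: (symbolP t) => [|M' U' u' h'|M' p' h']; first by rewrite level_root.
  have [_ ->] := parent_var h'; have := ltn_ord u' => h1 _ _ e.
  by move: h1; rewrite -e; lia.
have [-> ->] := parent_edge h' => _ [->] e; congr (_ |: _, _).
by apply: code_inj; have := code_bound p; have := code_bound p'; lia.
Qed.

Lemma rank_inj s t : valid s -> valid t -> rank s = rank t -> s = t.
Proof.
move: {2}(level s) (erefl (level s)) => k; elim: k s t => [|k IH] s t ls vs vt.
  rewrite {1}/rank ls /=; case: (posnP (level t)) => [/level0->|lt].
    by rewrite (level0 ls).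
  by rewrite (rankE vt lt); lia.
have ls0 : (0 < level s)%N by rewrite ls.
rewrite (rankE vs ls0); case: (posnP (level t)) => [lt|lt].
  have -> : rank t = 0 by rewrite /rank lt.
  by lia.
rewrite (rankE vt lt) => e.
have [vs' ls' _] := parent_props vs ls0; have [vt' lt' _] := parent_props vt lt.
have hs := position_bound s; have ht := position_bound t.
have e1 : rank (parent s) = rank (parent t).
  have := congr1 (divn^~ base) e.
  by rewrite !divnMDl // !divn_small // !addn0.
have e2 : position s = position t by move: e; rewrite e1; lia.
apply: sibling_inj => //; apply: IH => //.
by move: ls'; rewrite ls => -[].
Qed.

Lemma matching_add M p : matching M -> B p.1 p.2 ->
  (forall q, q \in M -> ~~ B q.1 p.2 && ~~ B p.1 q.2) -> matching (p |: M).
Proof.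
move=> /matchingP[h1 h2] Bp hq; apply/matchingP; split=> [q|q r].
  by rewrite in_setU1 => /orP[/eqP->|/h1].
rewrite !in_setU1 => /orP[/eqP->|qM] /orP[/eqP->|rM] //.
- by have /andP[_ /negbTE->] := hq _ rM.
- by have /andP[/negbTE-> _] := hq _ qM.
- exact: h2.
Qed.

Lemma matching_link M p q : matching (p |: M) -> q \in M -> p \notin M ->
  ~~ B q.1 p.2 && ~~ B p.1 q.2.
Proof.
move=> /matchingP[_ h] qM pM; apply/andP; split; apply/negP => hB.
  by move: pM; rewrite -(h _ _ _ _ hB) ?setU11 ?setU1r // qM.
by move: pM; rewrite (h _ _ _ _ hB) ?setU11 ?setU1r // qM.
Qed.

(** If a later edge f of the bipartite graph is joined to p, then one of the
    two vertices of f is a variable of the colon ideal at p, so f is redundant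
    there. *)
Lemma link_nbr p f : B p.1 p.2 -> B f.1 f.2 -> (code p < code f)%N ->
  B p.1 f.2 || B f.1 p.2 ->
  (p.2 < f.2)%N && B p.1 f.2 \/ (p.1 < f.1)%N && B f.1 p.2.
Proof.
rewrite code_lt => Bp Bf /orP[lt1|/andP[/eqP e lt2]] hB; last first.
  by left; rewrite lt2 e.
case/orP: hB => hB; last by right; rewrite lt1.
case: (ltngtP p.2 f.2) => h; first by left; rewrite hB.
  by right; rewrite lt1 (B_corner hB Bp Bf lt1 h).
by right; rewrite lt1 (ord_inj h) Bf.
Qed.

(** A variable y_k contributed by p alone comes from the edge (p.1, k), which
    can take the place of p in the matching. *)
Lemma exchange_y M p (k : 'I_n) : add_edge M p -> matching (p |: M) ->
  (p.2 < k)%N -> B p.1 k -> ~~ nbr M (rshift n k) -> matching ((p.1, k) |: M).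
Proof.
move=> [pM hp] mpM lt Bpk hn; have mM := matching_sub (subsetUr _ _) mpM.
have [h1 h2] := matchingP _ mM; have [h3 _] := matchingP _ mpM.
apply: matching_add => // q qM; have /andP[n1 n2] := matching_link mpM qM pM.
rewrite /= n2 andbT; apply/negP => hB.
have /orP[lq|/andP[/eqP e _]] : (q.1 < p.1)%N ||
  ((q.1 == p.1) && (q.2 < p.2)%N).
- by rewrite -code_lt hp.
- case: (ltngtP q.2 k) => h.
  + by case/nbr_y: hn; exists q.
  + by move: n2; rewrite (B_corner hB (h1 _ qM) Bpk lq h).
  + by move: n2; rewrite (ord_inj h) Bpk.
by move: n1; rewrite e (h3 _ (setU11 _ _)).
Qed.

Lemma exchange_x M p (a : 'I_n) : add_edge M p -> matching (p |: M) ->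
  (p.1 < a)%N -> B a p.2 -> ~~ nbr M (lshift n a) -> matching ((a, p.2) |: M).
Proof.
move=> [pM hp] mpM lt Bap hn; have mM := matching_sub (subsetUr _ _) mpM.
apply: matching_add => // q qM; have /andP[n1 n2] := matching_link mpM qM pM.
rewrite /= n1 /=; apply/negP => hB; case/nbr_x: hn; exists q; split=> //.
have := hp _ qM; rewrite code_lt => /orP[h|/andP[/eqP -> _]//].
exact: ltn_trans h lt.
Qed.

Lemma add_edge_lt M p q : add_edge M p -> (code p < code q)%N -> add_edge M q.
Proof.
move=> [pM hp] lt; have h r : r \in M -> (code r < code q)%N.
  by move=> /hp h; apply: ltn_trans h lt.
by split=> //; apply/negP => /h; rewrite ltnn.
Qed.

Lemma support_var M U u Z : support (M, u |: U) \subset Z =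
  (u \in Z) && (support (M, U) \subset Z).
Proof. by rewrite /support /= setUCA subUset sub1set. Qed.

Lemma support_edge M p Z : support (p |: M, set0) \subset Z =
  [&& lshift n p.1 \in Z, rshift n p.2 \in Z & support (M, set0) \subset Z].
Proof.
rewrite /support /= !setU0 /msupport bigcup_setU big_set1 subUset.
by rewrite /vars subUset !sub1set andbA.
Qed.

Lemma add_var0 M u : add_var M set0 u.
Proof. by split=> [|v]; rewrite inE. Qed.

Definition is_child c t := [&& valid c, (0 < level c)%N & parent c == t].

Lemma is_child_var M U u : add_var M U u -> valid (M, U) -> nbr M u ->
  is_child (M, u |: U) (M, U).
Proof.
move=> h v hu; have [e _] := parent_var h.
by rewrite /is_child valid_var v hu level_var //= e eqxx.
Qed.

Lemma is_child_edge M p : add_edge M p -> matching (p |: M) ->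
  is_child (p |: M, set0) (M, set0).
Proof.
move=> h v; have [e _] := parent_edge h.
by rewrite /is_child valid_edges v level_edge //= e eqxx.
Qed.

(** The colon ideals of the frame, in the form required by Schreyer's method.
    If the last choice was a variable, children and earlier siblings add the
    same earlier variables. If it was an edge p, a child that adds a variable
    contributed by p corresponds to the sibling that has, instead of p, the edge
    by which it is contributed. *)
Theorem symbol_colon t Z : valid t -> (0 < level t)%N -> support t \subset Z ->
  (exists c, is_child c t && (support c \subset Z)) <->
  (exists s, [&& is_child s (parent t), (rank s < rank t)%N &
    support s \subset Z]).
Proof.
move=> vt lt tZ.
have rk s : is_child s (parent t) -> (rank s < rank t)%N =
  (position s < position t)%N.
  by case/and3P => vs ls /eqP e; apply: rank_sibling.
suff : (exists c, is_child c t && (support c \subset Z)) <->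
  (exists s, [&& is_child s (parent t), (position s < position t)%N &
    support s \subset Z]).
  move=> ->; split=> -[s /and3P[h1 h2 h3]]; exists s;
    first by rewrite h1 rk ?h2.
  by rewrite h1 -rk ?h2.
clear rk; case: (symbolP t) vt lt tZ => [|M U u h|M p h].
- by rewrite level_root.
- rewrite valid_var => /andP[vMU hu] _; rewrite support_var => /andP[uZ sZ].
  have [-> ->] := parent_var h; have [uU ltU] := h.
  split=> [[c]|[s]] /andP[/and3P[]].
    case: (symbolP c) => [|M' U' u' h'|M' p' h']; first by rewrite level_root.
      have [-> _] := parent_var h';
        rewrite valid_var => /andP[v' hu'] _ /eqP[eM eU].
      rewrite {}eM {}eU {M' U'} in h' v' hu' *.
      rewrite support_var => /andP[u'Z _]; have [u'U ltU'] := h'.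
      have h'' : add_var M U u'.
        split; first by apply: contra u'U => ?; rewrite setU1r.
        by move=> v vU; apply: ltU'; rewrite setU1r.
      exists (M, u' |: U); rewrite is_child_var //= support_var u'Z sZ !andbT.
      by have [_ ->] := parent_var h''; apply: ltU'; rewrite setU11.
    have [-> _] := parent_edge h' => _ _ /eqP[_ /setP/(_ u)].
    by rewrite setU11 inE.
  case: (symbolP s) => [|M' U' u' h'|M' p' h']; first by rewrite level_root.
    have [-> ->] := parent_var h';
      rewrite valid_var => /andP[v' hu'] _ /eqP[eM eU].
    rewrite {}eM {}eU {M' U'} in h' v' hu' *.
    rewrite support_var => /and3P[ltu u'Z _]; have [u'U ltU'] := h'.
    exists (M, u' |: (u |: U));
      rewrite support_var u'Z support_var uZ sZ !andbT.
    apply: is_child_var; rewrite ?valid_var ?vMU //; split.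
      rewrite in_setU1 negb_or u'U andbT; apply: contraTneq ltu => ->.
      by rewrite ltnn.
    by move=> v; rewrite in_setU1 => /orP[/eqP->//|/ltU h2];
      apply: ltn_trans ltu h2.
  have [_ ->] := parent_edge h' => _ _ _ /andP[+ _].
  by have := ltn_ord u; lia.
rewrite valid_edges => mpM _; rewrite support_edge => /and3P[xZ yZ sZ].
have [-> ->] := parent_edge h; have [pM hp] := h.
have mM := matching_sub (subsetUr _ _) mpM.
have [h3 _] := matchingP _ mpM.
have posE f : (code p < code f)%N ->
  (n + n + (n * n - code f) < n + n + (n * n - code p))%N.
  by have := code_bound f; lia.
split=> [[c]|[s]] /andP[/and3P[]].
  case: (symbolP c) => [|M' U' u' h'|M' p' h']; first by rewrite level_root.
    have [-> _] := parent_var h';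
      rewrite valid_var => /andP[v' hu'] _ /eqP[eM eU].
    rewrite {}eM {}eU {M' U'} in h' v' hu' *.
    rewrite support_var => /andP[u'Z _].
    (* either the variable was available before p, or p contributes it *)
    have [nM|nM] := boolP (nbr M u').
      have vM : valid (M, set0) by rewrite valid_edges.
      exists (M, u' |: set0); rewrite (is_child_var (add_var0 M u') vM nM).
      rewrite support_var u'Z sZ !andbT /=.
      have [_ ->] := parent_var (add_var0 M u').
      exact: leq_trans (ltn_ord u') (leq_addr _ _).
    have [[a ea]|[k ek]] := var_case u'.
      move: hu'; rewrite ea => /nbr_x[q []];
        rewrite in_setU1 => /orP[/eqP->|qM] lta Ba; last first.
        by case/negP: nM; rewrite ea; apply/nbr_x; exists q.
      have ltc : (code p < code (a, p.2))%N by rewrite code_lt lta.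
      have h'' := add_edge_lt h ltc; have [_ e] := parent_edge h''.
      exists ((a, p.2) |: M, set0); rewrite is_child_edge ?e ?posE //=.
        by rewrite support_edge /= -ea u'Z yZ.
      by apply: exchange_x => //; rewrite -ea.
    move: hu'; rewrite ek => /nbr_y[q []];
      rewrite in_setU1 => /orP[/eqP->|qM] ltpk Bk; last first.
      by case/negP: nM; rewrite ek; apply/nbr_y; exists q.
    have ltc : (code p < code (p.1, k))%N by rewrite code_lt ltpk eqxx orbT.
    have h'' := add_edge_lt h ltc; have [_ e] := parent_edge h''.
    exists ((p.1, k) |: M, set0); rewrite is_child_edge ?e ?posE //=.
      by rewrite support_edge /= -ek u'Z xZ.
    by apply: exchange_y => //; rewrite -ek.
  have [-> _] := parent_edge h'; rewrite valid_edges => m' _ /eqP[eM].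
  rewrite {}eM {M'} in h' m' *.
  rewrite support_edge => /and3P[x'Z y'Z _].
  have [p'M hp'] := h'; have ltc := hp' _ (setU11 p M).
  have h'' := add_edge_lt h ltc; have [_ e] := parent_edge h''.
  exists (p' |: M, set0); rewrite is_child_edge ?e ?posE //=.
    by rewrite support_edge x'Z y'Z.
  by apply: matching_sub m'; apply: setUS; apply: subsetUr.
case: (symbolP s) => [|M' U' u' h'|M' f h']; first by rewrite level_root.
  have [-> ->] := parent_var h';
    rewrite valid_var => /andP[v' hu'] _ /eqP[eM eU].
  rewrite {}eM {}eU {M' U'} in h' v' hu' *.
  rewrite support_var => /and3P[_ u'Z _].
  exists (p |: M, u' |: set0);
    rewrite support_var u'Z support_edge xZ yZ sZ !andbT.
  apply: (is_child_var (add_var0 _ _)); first by rewrite valid_edges.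
  by apply: nbr_sub hu'; apply: subsetUr.
have [-> ->] := parent_edge h'; rewrite valid_edges => m' _ /eqP[eM].
rewrite {}eM {M'} in h' m' *.
rewrite support_edge => /and4P[ltp fxZ fyZ _].
have [fM hf] := h'; have [h5 _] := matchingP _ m'.
have ltc : (code p < code f)%N.
  move: ltp; rewrite ltn_add2l ltnNge; apply: contraR; rewrite -leqNgt.
  exact: leq_sub2l.
have Bp := h3 _ (setU11 _ _); have Bf := h5 _ (setU11 _ _).
have [/(link_nbr Bp Bf ltc) hl|] := boolP (B p.1 f.2 || B f.1 p.2).
  have child v : v \in Z -> nbr (p |: M) v ->
      exists c, is_child c (p |: M, set0) && (support c \subset Z).
    move=> vZ hv; exists (p |: M, v |: set0).
    rewrite support_var vZ support_edge xZ yZ sZ !andbT.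
    by apply: (is_child_var (add_var0 _ _)); rewrite ?valid_edges.
  case: hl => /andP[l1 l2]; [apply: child fyZ _ | apply: child fxZ _].
    by apply/nbr_y; exists p; rewrite setU11.
  by apply/nbr_x; exists p; rewrite setU11.
rewrite negb_or => nl.
exists (f |: (p |: M), set0); rewrite support_edge fxZ fyZ support_edge xZ yZ
  sZ !andbT.
apply: is_child_edge.
  split; first by rewrite in_setU1 negb_or fM andbT;
    apply: contraTneq ltc => ->; rewrite ltnn.
  by move=> q; rewrite in_setU1 => /orP[/eqP->//|/hf].
apply: matching_add => // q; rewrite in_setU1 => /orP[/eqP->//|qM].
exact: matching_link m' qM fM.
Qed.

(** * Matchings that are alone in their multidegree *)

Definition endpoints M :
  {set 'I_n} := [set p.1 | p in M] :|: [set p.2 | p in M].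

Lemma endpointsP M a :
  reflect (exists2 p, p \in M & a = p.1 \/ a = p.2) (a \in endpoints M).
Proof.
rewrite in_setU; apply: (iffP orP) =>
  [[/imsetP[p pM ->]|/imsetP[p pM ->]]|[p pM [->|->]]].
- by exists p; rewrite // ; left.
- by exists p; rewrite // ; right.
- by left; apply: imset_f.
- by right; apply: imset_f.
Qed.

Definition spread M := (\sum_(p in M) (p.2 - p.1))%N.

Lemma swap_card M p q : p \in M -> q \notin M -> #|q |: M :\ p| = #|M|.
Proof.
move=> pM qM; rewrite cardsU1 !inE (negbTE qM) andbF /= [RHS](cardsD1 p) pM.
by [].
Qed.

Lemma swap_spread M p q : p \in M -> q \notin M ->
  (p.2 - p.1 < q.2 - q.1)%N -> (spread M < spread (q |: M :\ p))%N.
Proof.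
move=> pM qM lt; rewrite /spread (big_setD1 p) //= big_setU1 /=; last first.
  by rewrite !inE (negbTE qM) andbF.
by rewrite ltn_add2r.
Qed.

(** Maximal size makes the regularity bound sharp; maximal spread among these
    excludes edges of G between the vertices of M that are not in M. *)
Definition optimal M :=
  [/\ matching M, forall M', matching M' -> (#|M'| <= #|M|)%N
  & forall M', matching M' -> #|M'| = #|M| -> (spread M' <= spread M)%N].

Lemma optimal_exists : exists M, optimal M.
Proof.
have m0 : matching set0.
  by apply/matchingP; split=> [p|p q]; rewrite inE.
have [M1 m1 h1] := arg_maxnP (fun M : {set edge} => #|M|) m0.
have h2 : matching M1 && (#|M1| == #|M1|) by rewrite m1 eqxx.
have [M /andP[m /eqP e] h3] :=
  @arg_maxnP _ M1 (fun M => matching M && (#|M| == #|M1|)) spread h2.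
exists M; split=> // M' m'; first by rewrite e; apply: h1.
by move=> e'; apply: h3; rewrite m' e' e eqxx.
Qed.

(** Otherwise take r in M with B r.1 t.1 and r.1 maximal. Replacing r by
    (r.1, t.1), which is longer, keeps the matching induced and increases the
    spread. *)
Lemma optimal_low M (s t : edge) :
  optimal M -> s \in M -> t \in M -> B s.1 t.1 ->
  (s.1, t.1) \in M.
Proof.
move=> [mM hc hs] sM tM Bst; apply/negPn/negP => nst.
have [h1 h2] := matchingP _ mM.
have h0 : (s \in M) && B s.1 t.1 by rewrite sM.
have [r /andP[rM Br] hr] := @arg_maxnP _ s (fun q => (q \in M) && B q.1 t.1)
  (fun q : edge => q.1 : nat) h0.
have nrt : (r.1, t.1) \notin M.
  apply: contra nst => rt.
  by rewrite (h2 _ _ sM rt Bst).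
have lt : (r.2 < t.1)%N.
  case: (ltngtP r.2 t.1) => // h.
    have e := h2 _ _ tM rM (B_up Br (h1 _ rM) h).
    by have := B_lt Br; rewrite e ltnn.
  by move: nrt; rewrite -(ord_inj h) -surjective_pairing rM.
have Brt := B_up (h1 _ rM) Br lt.
have m' : matching ((r.1, t.1) |: M :\ r).
  apply: matching_add => //=; first by apply: matching_sub mM; apply: subsetDl.
  move=> q; rewrite !inE => /andP[nq qM]; apply/andP; split; apply/negP => hB;
    last first.
    by move: nq; rewrite (h2 _ _ rM qM hB) eqxx.
  have [h|h] := ltnP q.1 r.2.
    have e := h2 _ _ qM rM (B_down hB Brt h).
    by rewrite e eqxx in nq.
  have : (q \in M) && B q.1 t.1 by rewrite qM.
  move/hr => hle; have := leq_trans h hle.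
  by rewrite leqNgt (B_lt (h1 _ rM)).
have key : (r.2 - r.1 < t.1 - r.1)%N.
  by apply: ltn_sub2r lt; apply: B_lt Br.
have := hs _ m' (swap_card rM nrt).
by rewrite leqNgt (swap_spread (q := (r.1, t.1)) rM nrt key).
Qed.

(** The mirror image of [optimal_low]. *)
Lemma optimal_high M (s t : edge) :
  optimal M -> s \in M -> t \in M -> B s.2 t.2 ->
  (s.2, t.2) \in M.
Proof.
move=> [mM hc hs] sM tM Bst; apply/negPn/negP => nst.
have [h1 h2] := matchingP _ mM.
have h0 : (t \in M) && B s.2 t.2 by rewrite tM.
have [r /andP[rM Br] hr] := @arg_minnP _ t (fun q => (q \in M) && B s.2 q.2)
  (fun q : edge => q.2 : nat) h0.
have nrt : (s.2, r.2) \notin M.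
  apply: contra nst => sr.
  by rewrite -(h2 _ _ sr tM Bst).
have lt : (s.2 < r.1)%N.
  case: (ltngtP s.2 r.1) => // h.
    have e := h2 _ _ rM sM (B_down (h1 _ rM) Br h).
    by have := B_lt Br; rewrite e ltnn.
  by move: nrt; rewrite (ord_inj h) -surjective_pairing rM.
have Bsr := B_down Br (h1 _ rM) lt.
have m' : matching ((s.2, r.2) |: M :\ r).
  apply: matching_add => //=; first by apply: matching_sub mM; apply: subsetDl.
  move=> q; rewrite !inE => /andP[nq qM]; apply/andP; split; apply/negP => hB.
    by move: nq; rewrite (h2 _ _ qM rM hB) eqxx.
  have [h|h] := ltnP r.1 q.2.
    have e := h2 _ _ rM qM (B_up Bsr hB h).
    by rewrite e eqxx in nq.
  have : (q \in M) && B s.2 q.2 by rewrite qM.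
  move/hr => hle; have := leq_trans (hle : (r.2 <= q.2)%N) h.
  by rewrite leqNgt (B_lt (h1 _ rM)).
have key : (r.2 - r.1 < r.2 - s.2)%N.
  by apply: ltn_sub2l lt; apply: B_lt Br.
have := hs _ m' (swap_card rM nrt).
by rewrite leqNgt (swap_spread (q := (s.2, r.2)) rM nrt key).
Qed.

(** In the only case not yet covered, (s.2, t.1) could be added to M. *)
Lemma optimal_pure M a b :
  optimal M -> a \in endpoints M -> b \in endpoints M ->
  B a b -> (a, b) \in M.
Proof.
move=> oM /endpointsP[s sM ha] /endpointsP[t tM hb] hB.
have [mM hc hs] := oM; have [h1 h2] := matchingP _ mM.
case: ha hb hB => -> [->|->] hB.
- exact: optimal_low.
- by rewrite -(h2 _ _ sM tM hB) -surjective_pairing.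
- apply/negPn/negP => nst.
  have m' : matching ((s.2, t.1) |: M).
    apply: matching_add => // q qM /=; apply/andP; split; apply/negP => hq.
      have qt := optimal_low oM qM tM hq.
      have eq := h2 _ _ qM qt (h1 _ qt).
      have hB' : B s.2 q.2 by rewrite eq.
      by have := optimal_high oM sM qM hB'; rewrite eq /= (negbTE nst).
    have sq := optimal_high oM sM qM hq.
    have eq := h2 _ _ sq qM hq.
    have hB' : B q.1 t.1 by rewrite -eq.
    by have := optimal_low oM qM tM hB'; rewrite -eq /= (negbTE nst).
  by have := hc _ m'; rewrite cardsU1 nst ltnn.
- exact: optimal_high.
Qed.

End Symbols.

(** * The lexicographic order *)

Section Lex.
Variable m : nat.
Implicit Types a b c : 'X_{1..m}.

Lemma lex_ltP a b : reflect
  (exists2 i : 'I_m, forall j : 'I_m, (j < i)%N -> a j = b j & (a i < b i)%N)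
  (lex_lt a b).
Proof.
apply: (iffP existsP) => [[i /andP[lt /forallP h]]|[i h lt]]; exists i.
  by move=> j ji; apply/eqP; apply: implyP (h j) ji.
  by [].
by rewrite lt; apply/forallP => j; apply/implyP => /h->.
Qed.

Lemma lex_irr a : lex_lt a a = false.
Proof. by apply/lex_ltP => -[i _]; rewrite ltnn. Qed.

Lemma lex_trans b a c : lex_lt a b -> lex_lt b c -> lex_lt a c.
Proof.
move=> /lex_ltP[i hi li] /lex_ltP[j hj lj]; apply/lex_ltP.
case: (ltngtP i j) => h.
- exists i => [k ki|]; last by rewrite -hj.
  by rewrite hi // hj // (ltn_trans ki h).
- exists j => [k kj|]; last by rewrite hi.
  by rewrite hi ?hj // (ltn_trans kj h).
have e : i = j by apply: val_inj.
exists i => [k ki|]; last by apply: ltn_trans li _; rewrite e.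
by rewrite hi // hj // -e.
Qed.

Lemma lex_total a b : a != b -> lex_lt a b || lex_lt b a.
Proof.
move=> nab; have [i hi] : exists i, a i != b i.
  apply/existsP; rewrite -negb_forall; apply: contra nab => /forallP h.
  by apply/eqP/mnmP => i; apply/eqP.
have [j /= hj jmin] := @arg_minnP _ i (fun i => a i != b i) (@nat_of_ord m) hi.
have low (k : 'I_m) : (k < j)%N -> a k = b k.
  by move=> kj; apply/eqP/negPn/negP => /jmin; rewrite leqNgt kj.
case: (ltngtP (a j) (b j)) hj => // h _; apply/orP; [left|right].
  by apply/lex_ltP; exists j.
by apply/lex_ltP; exists j => // k kj; rewrite low.
Qed.

Lemma lex_add c a b : lex_lt (c + a)%MM (c + b)%MM = lex_lt a b.
Proof.
apply/lex_ltP/lex_ltP => -[i h lt]; exists i.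
- by move=> j /h; rewrite !mnmDE => /addnI.
- by move: lt; rewrite !mnmDE ltn_add2l.
- by move=> j /h; rewrite !mnmDE => ->.
- by rewrite !mnmDE ltn_add2l.
Qed.

Lemma lex_max (s : seq 'X_{1..m}) : s != [::] ->
  exists2 a, a \in s & forall b, b \in s -> b != a -> lex_lt b a.
Proof.
elim: s => // x [|y s] IH _.
  by exists x; rewrite ?mem_head // => b; rewrite inE => /eqP->; rewrite eqxx.
have [//|a as' ha] := IH; have [exa|nxa] := eqVneq x a.
  exists a; first by rewrite in_cons as' orbT.
  by move=> b; rewrite in_cons exa => /orP[->|/ha].
have /orP[lt|lt] := lex_total nxa.
  exists a; first by rewrite in_cons as' orbT.
  by move=> b; rewrite in_cons => /orP[/eqP->|/ha].
exists x; first by rewrite mem_head.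
move=> b; rewrite in_cons => /orP[->//|hb] _.
have [->//|nba] := eqVneq b a.
exact: lex_trans (ha _ hb nba) lt.
Qed.

End Lex.

(** * Monomials and the vertex grading *)

Section Monomials.
Variable n : nat.
Notation edge := ('I_n * 'I_n)%type.

Definition sqfree m (Z : {set 'I_m}) :
  'X_{1..m} := [multinom (i \in Z : nat) | i < m].

Lemma sqfree_le m (Z : {set 'I_m}) (X : 'X_{1..m}) :
  (sqfree Z <= X)%MM = (Z \subset [set i | X i != 0%N]).
Proof.
apply/mnm_lepP/subsetP => h i.
  by move=> iZ; have := h i; rewrite mnmE iZ inE lt0n.
by rewrite mnmE; case: (boolP (i \in Z)) => // /h; rewrite inE lt0n.
Qed.

Lemma sqfreeU1 m (Z : {set 'I_m}) u : u \notin Z ->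
  sqfree (u |: Z) = (U_(u) + sqfree Z)%MM.
Proof.
move=> uZ; apply/mnmP => i; rewrite mnmDE !mnmE in_setU1 eq_sym.
by case: eqP => [<-|_] //=; rewrite (negbTE uZ).
Qed.

Lemma sqfree0 m : sqfree (set0 : {set 'I_m}) = 0%MM.
Proof. by apply/mnmP => i; rewrite mnmE inE mnm0E. Qed.

Lemma mdeg_sqfree m (Z : {set 'I_m}) : mdeg (sqfree Z) = #|Z|.
Proof.
rewrite mdegE -sum1_card [RHS]big_mkcond /=; apply: eq_bigr => i _.
by rewrite mnmE; case: (i \in Z).
Qed.

Lemma mnm_addCA m (a b c : 'X_{1..m}) : (a + (b + c) = b + (a + c))%MM.
Proof. by rewrite !addmA [(a + b)%MM]addmC. Qed.

(** The grading by vertices, for which x_i and y_i both have degree e_i. *)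
Definition vdeg (X : 'X_{1..n + n}) : 'X_{1..n} :=
  [multinom (X (lshift n i) + X (rshift n i))%N | i < n].

Lemma vdegD : {morph vdeg : X Y / (X + Y)%MM >-> (X + Y)%MM}.
Proof. by move=> X Y; apply/mnmP => i; rewrite mnmDE !mnmE; lia. Qed.

Lemma mdeg_vdeg X : mdeg (vdeg X) = mdeg X.
Proof.
rewrite !mdegE big_split_ord /= -big_split /=.
by apply: eq_bigr => i _; rewrite mnmE.
Qed.

Lemma vdeg_x a : vdeg U_(lshift n a) = U_(a)%MM.
Proof.
apply/mnmP => i; rewrite !mnmE !eq_lshift eq_lrshift addn0 //.
Qed.

Lemma vdeg_y a : vdeg U_(rshift n a) = U_(a)%MM.
Proof.
apply/mnmP => i; rewrite !mnmE !eq_rshift eq_rlshift add0n //.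
Qed.

(** The two monomials of the binomial of an edge. *)
Definition emon (p : edge) : 'X_{1..n + n} :=
  (U_(lshift n p.1) + U_(rshift n p.2))%MM.
Definition emon_swap (p : edge) : 'X_{1..n + n} :=
  (U_(lshift n p.2) + U_(rshift n p.1))%MM.

Lemma vdeg_emon_swap p : vdeg (emon_swap p) = vdeg (emon p).
Proof. by rewrite !vdegD !vdeg_x !vdeg_y addmC. Qed.

Lemma emon_swap_lt (p : edge) : (p.1 < p.2)%N -> (emon_swap p < emon p)%O.
Proof.
move=> lt; apply/ltmcP; first by rewrite !mdegD !mdeg1.
have nlt (i j : 'I_n) : (i < j)%N -> (j == i) = false.
  by move=> h; apply/negbTE; apply: contraTneq h => ->; rewrite ltnn.
exists (lshift n p.1) => [j|]; last first.
  by rewrite !mnmDE !mnm1E eqxx !eq_lshift !eq_rlshift (nlt _ _ lt).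
have [[a ->]|[k ->]] := var_case j => /=; last by have := ltn_ord p.1; lia.
move=> h; rewrite !mnmDE !mnm1E !eq_lshift !eq_rlshift.
by rewrite (nlt _ _ h) (nlt _ _ (ltn_trans h lt)).
Qed.

End Monomials.

Lemma emon_swap_lex n (p : 'I_n * 'I_n) :
  (p.1 < p.2)%N -> lex_lt (emon_swap p) (emon p).
Proof.
move=> lt; have := emon_swap_lt lt => /ltmcP;
  rewrite !mdegD !mdeg1 => /(_ erefl)[i h1 h2].
by apply/lex_ltP; exists i.
Qed.

(** * The resolution of the edge ideals *)

Lemma ideal_gen_sub (K : fieldType) m (P Q : {mpoly K[m]} -> Prop) :
  Q 0 -> (forall f g, Q f -> Q g -> Q (f + g)) ->
    (forall c g, P g -> Q (c * g)) ->
  forall f, ideal_gen P f -> Q f.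
Proof.
move=> Q0 QD QM f [s hs ->]; elim: s hs => [|[c g] s IH] hs.
  by rewrite big_nil.
rewrite big_cons; apply: QD; first by apply/QM/(hs (c, g))/mem_head.
by apply: IH => x xs; apply: hs; rewrite in_cons xs orbT.
Qed.

Section Frame.
Variables (n : nat) (B : rel 'I_n).
Notation edge := ('I_n * 'I_n)%type.
Implicit Types (M : {set edge}) (p q : edge).
Hypothesis B_lt : forall i j, B i j -> (i < j)%N.
Hypothesis B_up : forall i j k, B i j -> B i k -> (j < k)%N -> B j k.
Hypothesis B_down : forall i j k, B j i -> B k i -> (j < k)%N -> B j k.

(** The frame of symbols, transported to ordinals so that differentials are
    matrices. *)
Definition order := #|{: symbol n}|.
Notation N := order.
Definition sym (i : 'I_N) : symbol n := enum_val i.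
Definition idx (t : symbol n) : 'I_N := enum_rank t.

Lemma idxK t : sym (idx t) = t. Proof. exact: enum_rankK. Qed.
Lemma symK i : idx (sym i) = i. Proof. exact: enum_valK. Qed.
Lemma sym_inj : injective sym. Proof. exact: enum_val_inj. Qed.

Definition basis := [set i | valid B (sym i)].
Definition lev i := level (sym i).
Definition par i := idx (parent (sym i)).
Definition wt i := sqfree (support (sym i)).
Definition rk i := rank (sym i).
Definition root := idx (set0, set0).
Definition eidx p := idx ([set p], set0).

Lemma frame_parP t : t \in basis -> (0 < lev t)%N ->
  [/\ par t \in basis, lev t = (lev (par t)).+1 & (wt (par t) <= wt t)%MM].
Proof.
rewrite inE => vt lt; have [v' l' s'] := parent_props vt lt.
rewrite inE /lev /wt /par idxK; split=> //.
rewrite sqfree_le; apply: subset_trans s' _; apply/subsetP => u hu.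
by rewrite inE mnmE hu.
Qed.

Lemma frame_rk_inj : {in basis &, injective rk}.
Proof.
move=> s t; rewrite !inE => vs vt e; apply: sym_inj.
exact: rank_inj vs vt e.
Qed.

Lemma frame_rk_par s t : s \in basis -> t \in basis -> (0 < lev s)%N ->
  (0 < lev t)%N -> (rk (par s) < rk (par t))%N -> (rk s < rk t)%N.
Proof.
rewrite !inE /rk /par !idxK => vs vt ls lt; exact: (rank_parent vs vt ls lt).
Qed.

Lemma child_idx c t : child basis lev par (idx c) t = is_child B c (sym t).
Proof.
rewrite /child /is_child inE /lev /par idxK -{1}(symK t).
by rewrite (inj_eq (can_inj idxK)).
Qed.

Lemma frame_colonP t X : t \in basis -> (0 < lev t)%N -> (wt t <= X)%MM ->
  (exists c, child basis lev par c t && (wt c <= X)%MM) <->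
  (exists s, [&& child basis lev par s (par t), (rk s < rk t)%N &
    (wt s <= X)%MM]).
Proof.
rewrite inE sqfree_le => vt lt tX.
have := symbol_colon B_lt B_up B_down vt lt tX => h.
split=> -[c].
  rewrite -(symK c) child_idx sqfree_le idxK => hc.
  have [|s /and3P[h1 h2 h3]] := proj1 h; first by exists (sym c).
  by exists (idx s); rewrite child_idx sqfree_le /par /rk !idxK h1 h2 h3.
rewrite -(symK c) child_idx sqfree_le /rk /par !idxK => hc.
have [|s /andP[h1 h2]] := proj2 h; first by exists (sym c).
by exists (idx s); rewrite child_idx sqfree_le !idxK h1 h2.
Qed.

Lemma sym_root : sym root = (set0, set0). Proof. exact: idxK. Qed.
Lemma sym_eidx p : sym (eidx p) = ([set p], set0). Proof. exact: idxK. Qed.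

Lemma eidx_inj : injective eidx.
Proof. by move=> p q /(can_inj idxK) [] /set1_inj. Qed.

Lemma matching0 : matching B set0.
Proof. by apply/matchingP; split=> [p|p q]; rewrite inE. Qed.

Lemma matching1 p : matching B [set p] = B p.1 p.2.
Proof.
apply/matchingP/idP => [[h _]|h]; first by apply: h; rewrite set11.
by split=> [q|q r]; rewrite ?in_set1; [move/eqP-> | move=> /eqP-> /eqP->].
Qed.

Lemma root_basis : root \in basis.
Proof. by rewrite inE sym_root valid_edges matching0. Qed.

Lemma lev_root : lev root = 0%N.
Proof. by rewrite /lev sym_root level_root. Qed.

Lemma lev0 t : lev t = 0%N -> t = root.
Proof. by move=> /level0 e; apply: sym_inj; rewrite sym_root. Qed.

Lemma wt_root : wt root = 0%MM.
Proof.
rewrite /wt sym_root /support setU0 /msupport (big_pred0 _ _ _ _ (@in_set0 _)).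
exact: sqfree0.
Qed.

Lemma add_edge0 p : add_edge set0 p.
Proof. by split=> [|q]; rewrite inE. Qed.

Lemma eidx_basis p : (eidx p \in basis) = B p.1 p.2.
Proof. by rewrite inE sym_eidx valid_edges matching1. Qed.

Lemma lev_eidx p : lev (eidx p) = 1%N.
Proof. by rewrite /lev sym_eidx /level cards1 cards0. Qed.

Lemma par_eidx p : par (eidx p) = root.
Proof.
rewrite /par sym_eidx -[ [set p] ]setU0.
by have [-> _] := parent_edge (add_edge0 p).
Qed.

Lemma wt_eidx p : wt (eidx p) = emon p.
Proof.
rewrite /wt sym_eidx /support setU0 /msupport big_set1 /vars.
rewrite sqfreeU1 ?in_set1 ?eq_lrshift //.
by rewrite -[ [set rshift _ _] ]setU0 sqfreeU1 ?in_set0 // sqfree0 addm0.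
Qed.

Lemma lev1 t : t \in basis -> lev t = 1%N -> exists2 p, B p.1 p.2 & t = eidx p.
Proof.
rewrite inE /lev => vt lt; suff [p Bp e] : exists2 p, B p.1 p.2 & sym t =
  ([set p], set0).
  by exists p => //; apply: sym_inj; rewrite sym_eidx.
move: vt lt; case: (symbolP (sym t)) => [|M U u h|M p h].
- by rewrite level_root.
- rewrite valid_var level_var // => /andP[_ hu] [/level0[eM _]].
  move: hu; rewrite eM; have [[a ->]|[k ->]] := var_case u.
    by case/nbr_x => p []; rewrite inE.
  by case/nbr_y => p []; rewrite inE.
rewrite valid_edges level_edge // => vt [/level0[eM]].
by move: vt; rewrite eM setU0 matching1 => Bp; exists p.
Qed.

Lemma rk_eidx p q : B p.1 p.2 -> B q.1 q.2 -> (code q < code p)%N ->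
  (rk (eidx p) < rk (eidx q))%N.
Proof.
move=> Bp Bq lt; rewrite /rk !sym_eidx.
have hp := parent_edge (add_edge0 p); have hq := parent_edge (add_edge0 q).
case: hp hq => [pp p1] [pq q1].
have v r : B r.1 r.2 -> valid B ([set r], set0) by rewrite valid_edges
  matching1.
have l r : (0 < level ([set r] : {set edge}, set0 : {set 'I_(n + n)}))%N.
  by rewrite /level cards1.
rewrite setU0 in pp p1; rewrite setU0 in pq q1.
rewrite (rank_sibling (v _ Bp) (v _ Bq) (l p) (l q)) ?pp ?pq // p1 q1.
by have := code_bound p; lia.
Qed.

Lemma sqfree_support_var M U u : add_var M U u -> valid B (M, u |: U) ->
  sqfree (support (M, u |: U)) = (U_(u) + sqfree (support (M, U)))%MM.
Proof.
move=> [uU _]; rewrite valid_var => /andP[/andP[mM _] hu].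
rewrite /support /= setUCA sqfreeU1 // in_setU negb_or uU andbT.
exact: nbr_notin mM hu.
Qed.

Lemma sqfree_support_edge M p : p \notin M -> matching B (p |: M) ->
  sqfree (support (p |: M, set0)) = (emon p + sqfree (support (M, set0)))%MM.
Proof.
move=> pM mpM; have [h1 h2] := matchingP _ _ mpM.
have xn : lshift n p.1 \notin msupport M.
  apply/msupport_x => -[q qM e]; case/negP: pM.
  rewrite -(h2 q p) ?setU11 ?setU1r // e; apply: h1; exact: setU11.
have yn : rshift n p.2 \notin msupport M.
  apply/msupport_y => -[q qM e]; case/negP: pM.
  rewrite (h2 p q) ?setU11 ?setU1r // e; apply: h1; exact: setU11.
rewrite /support /= !setU0 /msupport bigcup_setU big_set1 /vars -setUA
  -/(msupport M).
rewrite sqfreeU1 ?in_setU1 ?negb_or ?eq_lrshift //.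
by rewrite sqfreeU1 // /emon addmA.
Qed.

Definition dg (i : 'I_order) := vdeg (wt i).

Section Field.
Variables (K : fieldType) (theta : bool).
Notation S := {mpoly K[n + n]}.

(** For theta = true these generate the binomial edge ideal, for theta = false
    its initial ideal. That theta is idempotent is what makes the S-pairs below
    reduce to zero in both cases. *)
Definition edge_binomial p : S := 'X_[emon p] - theta%:R *: 'X_[emon_swap p].

Definition first_diff : 'M[S]_N :=
  \sum_(p | B p.1 p.2) edge_binomial p *: delta_mx (eidx p) root.

Lemma eidx_root p : (eidx p == root) = false.
Proof.
by apply/negbTE/eqP => e; have := lev_eidx p; rewrite e lev_root.
Qed.

Lemma row_first_diff p : B p.1 p.2 ->
  row (eidx p) first_diff = edge_binomial p *: delta_mx 0 root.
Proof.
move=> Bp; apply/rowP => j; rewrite !mxE summxE (bigD1 p) //= !mxE eqxx.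
rewrite big1 ?addr0 // => q /andP[_ nq].
by rewrite !mxE (inj_eq eidx_inj) eq_sym (negbTE nq) mulr0.
Qed.

Lemma tcoef_gen p X s :
  tcoef wt (edge_binomial p *: delta_mx 0 root) X s != 0 ->
  s = root /\ (X = emon p \/ X = emon_swap p).
Proof.
rewrite /tcoef !mxE eqxx /=; case: (s =P root) => [->|_]; last first.
  by rewrite mulr0 mul0r mcoeff0 eqxx.
rewrite mulr1 wt_root mpolyX0 mulr1 /edge_binomial mcoeffB mcoeffZ !mcoeffX =>
  h; split=> //.
case: (emon p =P X) h => [->|_]; first by left.
case: (emon_swap p =P X) => [->|_]; first by right.
by rewrite mulr0 subrr eqxx.
Qed.

Notation leading_row := (leading_row basis lev par wt rk (@vdeg n)).
Notation truncated := (truncated basis lev par wt rk (@vdeg n)).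
Notation below_lead := (below_lead basis lev par wt rk (@vdeg n)).

Lemma truncated1 : truncated 1 first_diff.
Proof.
split.
- move=> c cA lc; have [|p Bp ->] := lev1 cA; first by move: lc; lia.
  rewrite row_first_diff //; split; rewrite par_eidx wt_eidx.
    rewrite /tcoef !mxE !eqxx mulr1 wt_root mpolyX0 mulr1 mcoeffB mcoeffZ
      !mcoeffX.
    rewrite eqxx (_ : (_ == _) = false) ?mulr0 ?subr0 //.
    by apply/negbTE/eqP => e; have := emon_swap_lt (B_lt Bp); rewrite e ltxx.
  move=> X s /tcoef_gen[-> hX]; split.
  + exact: root_basis.
  + by rewrite lev_eidx lev_root.
  + by case: hX => ->; [reflexivity | exact: vdeg_emon_swap].
  rewrite /key_le leqnn andbT orbC -le_eqVlt.
  by case: hX => -> //; apply: ltW; apply: emon_swap_lt (B_lt Bp).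
- move=> c hc; apply/rowP => j; rewrite !mxE summxE big1 // => p Bp.
  rewrite !mxE; case: eqP => [e|_]; last by rewrite mulr0.
  by move: hc; rewrite e eidx_basis Bp lev_eidx.
rewrite /first_diff mulmx_suml big1 // => p _.
rewrite mulmx_sumr big1 // => q _.
by rewrite -scalemxAl -scalemxAr mul_delta_mx_0 ?scaler0 // eq_sym eidx_root.
Qed.

Lemma mul_eidx (c : S) p : B p.1 p.2 ->
  (c *: delta_mx 0 (eidx p) : 'rV_N) *m first_diff =
    (c * edge_binomial p) *: delta_mx 0 root.
Proof. by move=> Bp; rewrite -scalemxAl -rowE row_first_diff // scalerA. Qed.

(** Buchberger's criterion. With p = (i,j) and writing g for the binomials, the
    relations are
    x_a g_ij - x_i g_aj - theta x_j g_ia = 0 if x_a is adjacent,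
    y_k g_ij - y_j g_ik + theta y_i g_jk = 0 if y_k is adjacent,
    and the trivial relation between g_p and g_q otherwise. Closedness
    provides the edges (i,a) and (j,k). *)
Lemma syzygy_row c : c \in basis -> lev c = 2%N ->
  exists v : 'rV[S]_N, leading_row c v /\ v *m first_diff = 0.
Proof.
move=> cA lc; have lc0 : (0 < lev c)%N by rewrite lc.
have [pA lp _] := frame_parP cA lc0.
have lev_par : lev (par c) = 1%N by move: lp; rewrite lc => -[].
have [p Bp ep] := lev1 pA lev_par.
have ltp := B_lt Bp.
have lead b (v : 'rV[S]_N) : wt c = (b + emon p)%MM -> below_lead c v ->
    leading_row c ((1 *: 'X_[b]) *: delta_mx 0 (eidx p) + v).
  by move=> hb hv; rewrite -ep; apply: leading_rowI => //; rewrite ep wt_eidx.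
have bel (a : K) b q : B q.1 q.2 -> vdeg (b + emon q)%MM = vdeg (wt c) ->
    key_lt (b + emon q)%MM (rk (eidx q)) (wt c) (rk (eidx p)) ->
    below_lead c ((a *: 'X_[b]) *: delta_mx 0 (eidx q)).
  move=> Bq hd hk; apply: below_lead_term;
    rewrite ?wt_eidx ?eidx_basis ?lev_eidx ?ep //.
have key_lt_rk X q : B q.1 q.2 -> X = wt c -> (code p < code q)%N ->
    key_lt X (rk (eidx q)) (wt c) (rk (eidx p)).
  by move=> Bq -> lt; rewrite /key_lt eqxx rk_eidx ?orbT.
have key_lt_mon X q : (X < wt c)%O ->
  key_lt X (rk (eidx q)) (wt c) (rk (eidx p)).
  by rewrite /key_lt => ->.
have := cA; rewrite inE.
have symc : sym (par c) = ([set p], set0) by rewrite ep sym_eidx.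
move: symc lc; rewrite /par idxK /lev.
have : wt c = sqfree (support (sym c)) by [].
case: (symbolP (sym c)) => [|M U u h|M q h].
- by rewrite level_root.
- have [-> _] := parent_var h => wc [eM eU] _ vc.
  move: wc; rewrite (sqfree_support_var h vc).
  move: vc; rewrite valid_var => /andP[_]; rewrite eM eU.
  rewrite -[support _]/(support ([set p], set0)) -(sym_eidx p) -/(wt _) wt_eidx.
  have [[a ->]|[k ->]] := var_case u.
    case/nbr_x => r []; rewrite in_set1 => /eqP-> lta Ba wc.
    have Bia := B_down Bp Ba lta.
    pose q : edge := (a, p.2); pose r' : edge := (p.1, a).
    have e1 : (U_(lshift n p.1) + emon q = U_(lshift n a) + emon p)%MM.
      by rewrite /emon /= mnm_addCA.
    have e2 : (U_(lshift n p.2) + emon r' = U_(lshift n p.1) + emon_swap q)%MM.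
      by rewrite /emon /emon_swap /= mnm_addCA.
    exists ((1 *: 'X_[U_(lshift n a)]) *: delta_mx 0 (eidx p) +
      ((-1 *: 'X_[U_(lshift n p.1)]) *: delta_mx 0 (eidx q) +
       ((- theta%:R) *: 'X_[U_(lshift n p.2)]) *: delta_mx 0 (eidx r'))); split.
      apply: lead => //; apply: below_leadD; apply: bel => //.
      + by rewrite wc e1.
      + by apply: key_lt_rk; rewrite ?wc // code_lt lta.
      + by rewrite wc e2 -e1 [LHS]vdegD [RHS]vdegD vdeg_emon_swap.
      + apply: key_lt_mon; rewrite wc e2 -e1 ltmc_add2r;
          exact: (@emon_swap_lt n q (B_lt Ba)).
    rewrite !mulmxDl !mul_eidx // -!scalerDl.
    rewrite [X in X *: _](_ : _ = 0) ?scale0r //.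
    rewrite /edge_binomial /emon /emon_swap /= !mpolyXD; case: (theta) => /=.
      by rewrite !scaleN1r !scale1r; ring.
    by rewrite oppr0 !scaleN1r !scale1r !scale0r; ring.
  case/nbr_y => r []; rewrite in_set1 => /eqP-> ltpk Bk wc.
  have Bjk := B_up Bp Bk ltpk.
  pose q : edge := (p.1, k); pose r' : edge := (p.2, k).
  have e1 : (U_(rshift n p.2) + emon q = U_(rshift n k) + emon p)%MM.
    by rewrite /emon /= mnm_addCA [RHS]mnm_addCA
      [(U_(rshift n p.2) + _)%MM]addmC.
  have e2 : (U_(rshift n p.1) + emon r' = U_(rshift n k) + emon_swap p)%MM.
    by rewrite /emon /emon_swap /= mnm_addCA [RHS]mnm_addCA
      [(U_(rshift n p.1) + _)%MM]addmC.
  exists ((1 *: 'X_[U_(rshift n k)]) *: delta_mx 0 (eidx p) +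
      ((-1 *: 'X_[U_(rshift n p.2)]) *: delta_mx 0 (eidx q) +
       (theta%:R *: 'X_[U_(rshift n p.1)]) *: delta_mx 0 (eidx r'))); split.
    apply: lead => //; apply: below_leadD; apply: bel => //.
    + by rewrite wc e1.
    + by apply: key_lt_rk; rewrite ?wc // code_lt eqxx ltpk orbT.
    + by rewrite wc e2 [LHS]vdegD [RHS]vdegD vdeg_emon_swap.
    + apply: key_lt_mon; rewrite wc e2 ltmc_add2r; exact: emon_swap_lt.
  rewrite !mulmxDl !mul_eidx // -!scalerDl.
  rewrite [X in X *: _](_ : _ = 0) ?scale0r //.
  rewrite /edge_binomial /emon /emon_swap /= !mpolyXD; case: (theta) => /=.
    by rewrite !scaleN1r !scale1r; ring.
  by rewrite !scaleN1r !scale1r !scale0r; ring.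
have [-> _] := parent_edge h => wc [eM] _ vc.
move: wc; rewrite valid_edges in vc; rewrite sqfree_support_edge //;
  last by case: h.
rewrite eM in h vc *.
rewrite -[support _]/(support ([set p], set0)) -(sym_eidx p) -/(wt _)
  wt_eidx => wc.
have [_ /(_ p)] := h; rewrite set11 => /(_ isT) ltc.
have [h1 _] := matchingP _ _ vc; have Bq := h1 q (setU11 _ _).
exists ((1 *: 'X_[emon q]) *: delta_mx 0 (eidx p) +
   (((- theta%:R) *: 'X_[emon_swap q]) *: delta_mx 0 (eidx p) +
    ((-1 *: 'X_[emon p]) *: delta_mx 0 (eidx q) +
     (theta%:R *: 'X_[emon_swap p]) *: delta_mx 0 (eidx q)))); split.
  apply: lead => //; apply: below_leadD; last apply: below_leadD;
    apply: bel => //.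
  + by rewrite wc [LHS]vdegD [RHS]vdegD vdeg_emon_swap.
  + apply: key_lt_mon; rewrite wc ltmc_add2l; exact: emon_swap_lt (B_lt Bq).
  + by rewrite wc addmC.
  + by apply: key_lt_rk => //; rewrite wc addmC.
  + by rewrite wc [LHS]vdegD [RHS]vdegD vdeg_emon_swap addmC.
  + apply: key_lt_mon; rewrite wc addmC ltmc_add2r; exact: emon_swap_lt.
rewrite !mulmxDl !mul_eidx // -!scalerDl.
rewrite [X in X *: _](_ : _ = 0) ?scale0r //.
rewrite /edge_binomial; case: (theta) => /=.
  by rewrite !scaleN1r !scale1r; ring.
by rewrite oppr0 !scaleN1r !scale1r !scale0r; ring.
Qed.

Definition edge_ideal (f : S) :=
  exists c : edge -> S, f = \sum_(p | B p.1 p.2) c p * edge_binomial p.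

Lemma mul_first_diff (u : 'rV[S]_N) :
  (u *m first_diff) 0 root =
  \sum_(p | B p.1 p.2) u 0 (eidx p) * edge_binomial p.
Proof.
rewrite /first_diff mulmx_sumr summxE; apply: eq_bigr => p _.
rewrite -scalemxAr !mxE (bigD1 (eidx p)) //= !mxE !eqxx mulr1 big1 ?addr0.
  by rewrite mulrC.
by move=> t nt; rewrite mxE (negbTE nt) mulr0.
Qed.

Lemma edge_idealP (D : 'M[S]_N) f :
  (forall u : 'rV[S]_N, (u *m D) 0 root = (u *m first_diff) 0 root) ->
  edge_ideal f <-> exists u : 'rV[S]_N, f = (u *m D) 0 root.
Proof.
move=> h; split=> [[c ->]|[u ->]]; last first.
  by exists (fun p => u 0 (eidx p)); rewrite h mul_first_diff.
exists (\sum_(p | B p.1 p.2) c p *: delta_mx 0 (eidx p)).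
rewrite h mulmx_suml summxE; apply: eq_bigr => p Bp.
by rewrite mul_eidx // !mxE !eqxx mulr1.
Qed.

(** Entries in the column of the root occur only in rows of level one, so the
    ideal presented by D is the one generated by the edge binomials. *)
Theorem frame_complex : exists D : 'M[S]_N,
  [/\ forall c, c \in basis -> (0 < lev c)%N -> leading_row c (row c D),
      D *m D = 0,
      forall u : 'rV[S]_N,
        (u *m D) 0 root = (u *m first_diff) 0 root
    & graded_complex lev dg root (@vdeg n) basis D edge_ideal].
Proof.
have p1 := truncated1.
have [|D2 hD2 low2] := truncated_ext p1.
  by move=> c cA lc; apply: syzygy_row.
have [D [Drow D0 DD low exa]] := schreyer_complex (@vdegD n) frame_parP
  frame_rk_inj frame_rk_par frame_colonP hD2.
have [_ z1 _] := p1.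
have entry t : D t root = first_diff t root.
  have [lt|lt] := leqP (lev t) 1.
    have := low t (leq_trans lt (leqnSn 1)); rewrite low2 // => /rowP/(_ root).
    by rewrite !mxE.
  have -> : first_diff t root = 0.
    have /rowP/(_ root) : row t first_diff = 0.
      by apply: z1; rewrite [(_ <= 1)%N]leqNgt lt !andbF.
    by rewrite !mxE.
  apply/eqP/negPn/negP => nz.
  have tA : t \in basis.
    apply/negPn/negP => tA; case/negP: nz; apply/eqP.
    have /rowP/(_ root) : row t D = 0 by apply: D0; rewrite (negbTE tA).
    by rewrite !mxE.
  have [_ tle] := Drow t tA (ltnW lt).
  have [|X /tle[_ le _ _]] := @tcoef_ex K _ _ wt (row t D) root.
    by rewrite mxE.
  by move: lt; rewrite le lev_root.
have entries (u : 'rV[S]_N) :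
    (u *m D) 0 root = (u *m first_diff) 0 root.
  by rewrite !mxE; apply: eq_bigr => t _; rewrite entry.
have row_ok s t : D s t != 0 -> s \in basis /\ (0 < lev s)%N.
  move=> nz; apply/andP/negPn/negP => h; case/negP: nz; apply/eqP.
  by have /rowP/(_ t) : row s D = 0 by [exact: D0]; rewrite !mxE.
exists D; split=> //; split=> //.
- move=> s t nz; have [sA ls] := row_ok _ _ nz.
  have [_ sle] := Drow s sA ls.
  have [|X /sle[tA le _ _]] := @tcoef_ex K _ _ wt (row s D) t;
    first by rewrite mxE.
  by [].
- move=> s t a ha; have [|sA ls] := row_ok s t.
    by apply: contraTneq ha => ->; rewrite msupp0.
  have [_ sle] := Drow s sA ls.
  have := sle (a + wt t)%MM t;
    rewrite -mcoeff_tcoef mxE -mcoeff_msupp => /(_ ha)[_ _ h _].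
  by rewrite /dg -vdegD.
- by move=> f; apply: edge_idealP.
Qed.

(** Write f with a reduced coefficient vector u. The products of the terms of
    u with the leading monomials x_i y_j are then distinct, so the
    lexicographically largest of them survives in f. The terms of f need not
    have the same total degree, hence the passage from the order used for the
    division to the pure lexicographic one. *)
Lemma lex_lead_div (f : S) a : edge_ideal f -> is_lex_lead f a ->
  exists2 p, B p.1 p.2 & (emon p <= a)%MM.
Proof.
have [D [Drow DD entries _]] := frame_complex.
case=> c fE [af amax].
pose v : 'rV[S]_N := \sum_(p | B p.1 p.2) c p *: delta_mx 0 (eidx p).
have hv t : v 0 t != 0 -> t \in basis /\ lev t = 1%N.
  move=> nz; have [p Bp ->] : exists2 p, B p.1 p.2 & t = eidx p.
    have [/existsP[p /andP[Bp /eqP->]]|/existsPn h] :=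
      boolP [exists p, B p.1 p.2 && (t == eidx p)]; first by exists p.
    case/negP: nz; rewrite summxE big1 // => p Bp; rewrite !mxE.
    by have := h p; rewrite Bp /= => /negbTE->; rewrite mulr0.
  by rewrite eidx_basis lev_eidx.
have [u [uD ured hu]] := reduce_level1 frame_parP
  frame_rk_inj Drow DD hv.
have {}fE : f = \sum_(p | B p.1 p.2) u 0 (eidx p) * edge_binomial p.
  rewrite -mul_first_diff -entries uD entries /v mulmx_suml summxE fE.
  by apply: eq_bigr => p Bp; rewrite mul_eidx // !mxE !eqxx mulr1.
pose s := [seq (b + emon p)%MM | p <- enum [pred p : edge | B p.1 p.2],
  b <- msupp (u 0 (eidx p))].
have sP X : reflect (exists p b,
  [/\ B p.1 p.2, b \in msupp (u 0 (eidx p)) & X = (b + emon p)%MM]) (X \in s).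
  apply: (iffP allpairsPdep) => -[p [b [h1 h2 ->]]]; exists p, b; split=> //.
    by move: h1; rewrite mem_enum.
  by rewrite mem_enum.
have edge_binomialE p X : (u 0 (eidx p) * edge_binomial p)@_X =
    (u 0 (eidx p) * 'X_[emon p])@_X - theta%:R *
      (u 0 (eidx p) * 'X_[emon_swap p])@_X.
  by rewrite /edge_binomial mulrBr mcoeffB -scalerAr mcoeffZ.
(* every monomial of f is at most the product of some term with its x_i y_j *)
have bounded X : X \in msupp f -> exists2 Y, Y \in s & X = Y \/ lex_lt X Y.
  rewrite mcoeff_msupp fE raddf_sum /= => nz.
  have [/existsP[p /andP[Bp hp]]|/existsPn h] := boolP [exists p : edge,
      B p.1 p.2 && ((u 0 (eidx p) * edge_binomial p)@_X != 0)]; last first.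
    case/negP: nz; rewrite big1 // => p Bp; apply/eqP/negPn/negP => hp.
    by have := h p; rewrite Bp hp.
  have [h|h] := eqVneq ((u 0 (eidx p) * 'X_[emon p])@_X) 0.
    move: hp; rewrite edge_binomialE h sub0r oppr_eq0 mulf_eq0 negb_or =>
      /andP[_ h'].
    have [le hb] := mcoeffMX_neq0 h'; exists (X - emon_swap p + emon p)%MM.
      by apply/sP; exists p, (X - emon_swap p)%MM; rewrite mcoeff_msupp hb.
    right; rewrite -{1}(submK le) lex_add; apply: emon_swap_lex; exact: B_lt.
  case/mcoeffMX_neq0: (h) => le hb; exists X; last by left.
  by apply/sP; exists p, (X - emon p)%MM; rewrite submK // mcoeff_msupp hb.
have [Y0 Y0s _] := bounded a af.
have [|X Xs Xmax] := @lex_max _ s; first by apply: contraTneq Y0s => ->.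
have /sP[p [b [Bp hb eX]]] := Xs; exists p => //.
suff -> : a = X by rewrite eX lem_addl.
have second q : B q.1 q.2 -> (u 0 (eidx q) * 'X_[emon_swap q])@_X = 0.
  move=> Bq; apply/eqP/negPn/negP => h; have [le e] := mcoeffMX_neq0 h.
  have Zs : (X - emon_swap q + emon q)%MM \in s.
    by apply/sP; exists q, (X - emon_swap q)%MM; rewrite mcoeff_msupp e h.
  have ltXZ : lex_lt X (X - emon_swap q + emon q)%MM.
    by rewrite -{1}(submK le) lex_add; apply/emon_swap_lex/B_lt.
  have [eZ|nZ] := eqVneq (X - emon_swap q + emon q)%MM X.
    by rewrite eZ lex_irr in ltXZ.
  by have := lex_trans ltXZ (Xmax _ Zs nZ); rewrite lex_irr.
have nX : f@_X != 0.
  rewrite fE raddf_sum /= (bigD1 p) //= big1 ?addr0; last first.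
    move=> q /andP[Bq nq]; rewrite edge_binomialE.
    have [->|h] := eqVneq ((u 0 (eidx q) * 'X_[emon q])@_X) 0; last first.
      case/eqP: nq; apply: eidx_inj.
      apply: (reduced_uniq frame_rk_inj frame_colonP (X := X) ured).
      - by rewrite eidx_basis.
      - by rewrite eidx_basis.
      - by rewrite lev_eidx.
      - by rewrite lev_eidx.
      - by rewrite !par_eidx.
      - by rewrite /tcoef wt_eidx.
      - by rewrite /tcoef wt_eidx eX addmC mcoeffMX -mcoeff_msupp.
    by rewrite second // mulr0 subr0.
  by rewrite edge_binomialE second // mulr0 subr0 eX addmC mcoeffMX
    -mcoeff_msupp.
apply/eqP/negPn/negP => naX.
have [Y Ys hY] := bounded a af.
have ltX : lex_lt X a by apply: amax; rewrite ?mcoeff_msupp // eq_sym.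
have [eYX|nYX] := eqVneq Y X.
  case: hY => [eaY|h]; first by rewrite eaY eYX lex_irr in ltX.
  by have := lex_trans ltX h; rewrite eYX lex_irr.
have ltYX := Xmax _ Ys nYX.
have : lex_lt X Y by case: hY => [<-|] //; apply: lex_trans ltX.
by move=> h; have := lex_trans h ltYX; rewrite lex_irr.
Qed.

End Field.

Lemma vdeg_neq0 (Z : {set 'I_(n + n)}) a :
  (vdeg (sqfree Z) a != 0%N) = (lshift n a \in Z) || (rshift n a \in Z).
Proof. by rewrite !mnmE; case: (_ \in _); case: (_ \in _). Qed.

Lemma mdeg_support t :
  valid B t -> mdeg (sqfree (support t)) = (2 * #|t.1| + #|t.2|)%N.
Proof.
case/andP=> mM /forall_inP hU; rewrite mdeg_sqfree /support cardsU.
rewrite (matching_card mM) (_ : _ :&: _ = set0) ?cards0 ?subn0 //.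
apply/setP => u; rewrite in_setI in_set0;
  apply/negP => /andP[h /hU/(nbr_notin mM)].
by rewrite h.
Qed.

(** A symbol with this multidegree involves only vertices of M, hence only
    edges of M, and two edges of M are never adjacent, so no variable can be
    chosen; the total degree then forces all edges of M to be present. *)
Lemma optimal_degree_uniq M t : optimal B M -> valid B t ->
  vdeg (sqfree (support t)) = vdeg (sqfree (support (M, set0))) -> t =
    (M, set0).
Proof.
move=> oM vt e; have [mM _ _] := oM; have [h1 h2] := matchingP _ _ mM.
case: t vt e => M' U vt e; have /andP[/= mM' /forall_inP hU] := vt.
have [h1' h2'] := matchingP _ _ mM'.
have endp a : (lshift n a \in support (M', U)) ||
  (rshift n a \in support (M', U)) ->
    a \in endpoints M.
  rewrite -vdeg_neq0 e vdeg_neq0 /support setU0 =>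
    /orP[/msupport_x|/msupport_y] [p pM <-].
    by apply/endpointsP; exists p => //; left.
  by apply/endpointsP; exists p => //; right.
have pM p : p \in M' -> [/\ p.1 \in endpoints M, p.2 \in endpoints M & p \in M].
  move=> pM'; have x1 : p.1 \in endpoints M.
    by apply: endp; rewrite in_setU (introT (msupport_x _ _)) //; exists p.
  have x2 : p.2 \in endpoints M.
    by apply: endp; rewrite !in_setU (introT (msupport_y _ _)) ?orbT //;
      exists p.
  by split=> //; rewrite [p]surjective_pairing;
    apply: (optimal_pure B_lt) oM _ _ (h1' _ pM').
have U0 : U = set0.
  apply/eqP; rewrite -subset0; apply/subsetP => u uU; exfalso.
  have := hU _ uU; have [[a ea]|[k ek]] := var_case u.
    rewrite ea => /nbr_x[p [/pM[_ x2 pM1] lt Ba]].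
    have ha : a \in endpoints M by apply: endp; rewrite -ea in_setU uU orbT.
    have aM := optimal_pure B_lt B_up B_down oM ha x2 Ba.
    by move: lt; rewrite -(h2 _ _ aM pM1 Ba) ltnn.
  rewrite ek => /nbr_y[p [/pM[x1 _ pM1] lt Bk]].
  have hk : k \in endpoints M by apply: endp; rewrite -ek !in_setU uU !orbT.
  have kM := optimal_pure B_lt B_up B_down oM x1 hk Bk.
  by move: lt; rewrite (h2 _ _ pM1 kM Bk) ltnn.
rewrite U0; congr (_, _); apply/eqP; rewrite eqEcard; apply/andP; split.
  by apply/subsetP => p /pM[].
have vM : valid B (M, set0) by rewrite valid_edges.
have := congr1 mdeg e; rewrite !mdeg_vdeg !mdeg_support // U0 /= cards0; lia.
Qed.

(** The level over S/I is the homological degree over I plus one, whence the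
    shift by one. *)
Theorem edge_ideal_reg M (K : fieldType) (theta : bool) I :
  optimal B M -> (forall f, I f <-> @edge_ideal K theta f) ->
  is_reg I (if #|M| is 0%N then None else Some (#|M|.+1)%:Z).
Proof.
move=> oM hI; have [mM hmax _] := oM.
have [D [_ _ _ cplx]] := frame_complex K theta.
have {}cplx : graded_complex lev dg root (@vdeg n) basis D I.
  case: cplx => c1 c2 c3 c4 c5; split=> // f; rewrite hI; exact: c5.
have [A [D' [sA c' m' u']]] := minimal_complex (@vdegD n) (@mdeg_vdeg n)
  lev_root root_basis cplx.
have lv0' t : t \in A -> lev t = 0%N -> t = root by move=> _; apply: lev0.
have dg_root : dg root = 0%MM.
  by rewrite /dg wt_root; apply/eqP; rewrite -mdeg_eq0 mdeg_vdeg mdeg0.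
pose F := resolution (@mdeg_vdeg n) (lev_root) lv0' c' m' dg_root.
have bet i j : betti F i j != 0%N -> exists2 t, valid B t &
    (i.+1 = #|t.1| + #|t.2| /\ j = 2 * #|t.1| + #|t.2|)%N.
  move/betti_resolution => [t [/(subsetP sA) tA lt dt]]; rewrite inE in tA.
  by exists (sym t) => //; rewrite -mdeg_support // -lt -dt /dg mdeg_vdeg.
exists F; case eM: #|M| => [|r].
  move=> i j; apply/eqP/negPn/negP => /bet[t vt [ei _]].
  have /andP[mt /forall_inP hU] := vt; have := hmax _ mt;
    rewrite eM leqn0 cards_eq0.
  move/eqP=> t0; move: ei; rewrite t0 cards0 add0n => /eqP.
  rewrite eq_sym => /eqP e; have /card_gt0P[u /hU] : (0 < #|t.2|)%N by rewrite
    e.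
  rewrite t0; have [[a ->]|[k ->]] := var_case u.
    by case/nbr_x => p []; rewrite inE.
  by case/nbr_y => p []; rewrite inE.
split.
  exists r, (2 * r.+1)%N; split; last by lia.
  apply/betti_resolution; exists (idx (M, set0)).
  have vM : valid B (M, set0) by rewrite valid_edges.
  rewrite /lev /dg /wt idxK mdeg_vdeg mdeg_support //= /level /= eM cards0
    !addn0.
  split=> //; apply: u' => [|s]; rewrite inE ?idxK //.
  rewrite /dg /wt idxK => vs /(optimal_degree_uniq oM vs) e.
  by apply: sym_inj; rewrite idxK.
move=> i j /bet[t vt [ei ej]]; have /andP[mt _] := vt; have := hmax _ mt.
rewrite eM; lia.
Qed.

Lemma edge_ideal0 (K : fieldType) theta : @edge_ideal K theta 0.
Proof. by exists (fun=> 0); rewrite big1 // => p _; rewrite mul0r. Qed.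

Lemma edge_idealD (K : fieldType) theta f g :
  @edge_ideal K theta f -> edge_ideal theta g -> edge_ideal theta (f + g).
Proof.
move=> [c ->] [d ->]; exists (fun p => c p + d p); rewrite -big_split /=.
by apply: eq_bigr => p _; rewrite mulrDl.
Qed.

Lemma edge_ideal_gen (K : fieldType) theta c p : B p.1 p.2 ->
  edge_ideal theta (c * edge_binomial K theta p).
Proof.
move=> Bp; exists (fun q => if q == p then c else 0).
rewrite (bigD1 p) //= eqxx big1 ?addr0 // => q /andP[_ /negbTE->].
by rewrite mul0r.
Qed.

Lemma edge_ideal_sub (K : fieldType) theta P f :
  (forall p, B p.1 p.2 -> P (edge_binomial K theta p)) -> edge_ideal theta f ->
    ideal_gen P f.
Proof.
move=> hP [c ->].
exists [seq (c p, edge_binomial K theta p) | p <- enum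
  [pred p : edge | B p.1 p.2]].
  by move=> x /mapP[p]; rewrite mem_enum => Bp ->; apply: hP.
by rewrite big_map big_enum.
Qed.

End Frame.

Lemma edge_binomial_true (K : fieldType) n (i j : 'I_n) :
  edge_binomial K true (i, j) = xvar K i * yvar K j - xvar K j * yvar K i.
Proof. by rewrite /edge_binomial /emon /emon_swap !mpolyXD scale1r. Qed.

Lemma edge_binomial_false (K : fieldType) n (p : 'I_n * 'I_n) :
  edge_binomial K false p = 'X_[emon p].
Proof. by rewrite /edge_binomial scale0r subr0. Qed.

(** * Closed graphs *)

Section Closed.
Variables (n : nat) (e : rel 'I_n).
Hypotheses (he : simple_graph e) (hcl : closed_labeling e).

Definition up_edge (i j : 'I_n) := (i < j)%N && e i j.

Lemma up_edge_lt i j : up_edge i j -> (i < j)%N. Proof. by case/andP. Qed.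

Lemma up_edge_up i j k : up_edge i j -> up_edge i k -> (j < k)%N -> up_edge j k.
Proof.
move=> /andP[ij eij] /andP[ik eik] jk; rewrite /up_edge jk.
apply: (hcl eij eik); last by rewrite ij ik.
by apply: contraTneq jk => ->; rewrite ltnn.
Qed.

Lemma up_edge_down i j k :
  up_edge j i -> up_edge k i -> (j < k)%N -> up_edge j k.
Proof.
have [es _] := he; move=> /andP[ji eji] /andP[ki eki] jk; rewrite /up_edge jk.
rewrite es in eji; rewrite es in eki.
apply: (hcl eji eki); last by rewrite ji ki orbT.
by apply: contraTneq jk => ->; rewrite ltnn.
Qed.

Lemma binomial_edge_idealE (K : fieldType) f :
  binomial_edge_ideal K e f <-> edge_ideal up_edge true f.
Proof.
split; last first.
  by apply: edge_ideal_sub => -[i j] /andP[lt eij]; exists i, j;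
    rewrite edge_binomial_true.
apply: ideal_gen_sub; [exact: edge_ideal0 | exact: edge_idealD |].
move=> c g [i [j [lt eij ->]]]; rewrite -edge_binomial_true.
by apply: edge_ideal_gen; rewrite /up_edge lt.
Qed.

(** Each leading monomial of J_G is divisible by some x_i y_j by
    [lex_lead_div]. *)
Lemma in_lexE (K : fieldType) f :
  in_lex (binomial_edge_ideal K e) f <-> edge_ideal up_edge false f.
Proof.
split; last first.
  apply: edge_ideal_sub => p Bp; exists (edge_binomial K true p), (emon p).
  split; last exact: edge_binomial_false.
    by apply/binomial_edge_idealE; rewrite -[edge_binomial _ _ _]mul1r;
      apply: edge_ideal_gen.
  have lt := emon_swap_lex (up_edge_lt Bp).
  have ne : emon_swap p != emon p by apply: contraTneq lt => ->;
    rewrite lex_irr.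
  split; first by rewrite mcoeff_msupp /edge_binomial mcoeffB mcoeffZ !mcoeffX
    eqxx (negbTE ne) mulr0 subr0 oner_neq0.
  move=> b; rewrite /edge_binomial scale1r => /msuppB_le;
    rewrite !msuppX mem_cat !mem_seq1.
  by case/orP => /eqP->; rewrite ?eqxx.
apply: ideal_gen_sub; [exact: edge_ideal0 | exact: edge_idealD |].
move=> c g [h [a [/binomial_edge_idealE hJ ha ->]]].
have [p Bp le] := lex_lead_div up_edge_lt up_edge_up up_edge_down hJ ha.
rewrite -(submK le) mpolyXD mulrA -edge_binomial_false; exact: edge_ideal_gen.
Qed.

End Closed.

Theorem corollary2p6 (n : nat) (e : rel 'I_n)
    (he : simple_graph e) (hcl : closed_labeling e) :
  (exists r : option int, forall K : fieldType,
     is_reg (binomial_edge_ideal K e) r) /\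
  (exists r : option int, forall K : fieldType,
     is_reg (in_lex (binomial_edge_ideal K e)) r).
Proof.
have [M oM] := optimal_exists (up_edge e).
have lt := @up_edge_lt n e.
have up := up_edge_up hcl; have down := up_edge_down he hcl.
split; eexists => K; apply: (edge_ideal_reg lt up down oM) => f.
  exact: binomial_edge_idealE.
exact: in_lexE.
Qed.
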